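(* Let $f=0$, $W=1$, $D(\cdot)=\sin(\cdot)$, and let the scaling factors $0<\alpha_n\le1$ satisfy $\frac{\log(n)/n}{\alpha_n^3}\to0$ as $n\to\infty$. Let $\theta(t,x)$ be the solution of the homogeneous continuum Kuramoto model $$\partial_t\theta(t,x)=\int_0^1\sin(\theta(t,y)-\theta(t,x))\,dy,\quad x\in[0,1],$$ and suppose that the initial condition $\theta(0,\cdot)$ belongs to $C([0,1])$ and is such that there exists a constant $c$ for which $\lim_{t\to\infty}\|\theta(t,\cdot)-c\|_{L^\infty([0,1])}=0$. For each $n$ let $\theta^n(t)=(\theta^n_1(t),\dots,\theta^n_n(t))$ be the solution of the sampled system $$\dot\theta^n_i(t)=\frac{1}{n\alpha_n}\sum_{j=1}^nA^{(n)}_{ij}\sin(\theta^n_j(t)-\theta^n_i(t)),\qquad i=1,\dots,n,$$ with initial condition $\theta^n(0,x)=\sum_{i=1}^n\theta^n_i(0)\mathbb{1}_{\left[\frac{i-1}{n},\frac in\right]}(x)$, where $\theta^n_i(0)=\theta\left(0,\frac{i-1}{n}\right)$. Fix $\delta>0$. There exist some constant $\widetilde c$ and $\bar n\in\mathbb{N}$ such that for each $n>\bar n$, $$\lim_{t\to\infty}\|\theta^n(t)-\widetilde c\|_\infty=0$$ with probability at least $1-\delta$.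
   Context: Here $f$ denotes the uncoupled dynamics of each oscillator, $W$ the graphon, and $D$ the coupling function; the displayed systems are what the general continuum system $\partial_t\theta(t,x)=f(\theta(t,x))+\int_0^1W(x,y)D(\theta(t,y)-\theta(t,x))\,dy$ and the general sampled system $\dot\theta^n_i=f(\theta^n_i)+\frac1{n\alpha_n}\sum_jA^{(n)}_{ij}D(\theta^n_j-\theta^n_i)$ become for these choices. $A^{(n)}$ is the random symmetric $n\times n$ adjacency matrix in which $A^{(n)}_{ij}=A^{(n)}_{ji}$ is a Bernoulli random variable with success probability $\alpha_n$, the entries with $1\le i\le j\le n$ being independent (an Erdős–Rényi random graph with edge probability $\alpha_n$). Phases are real-valued. $\mathbb{1}_E$ is the characteristic function of the set $E$. For a vector $v\in\mathbb{R}^n$ and a constant $\widetilde c$, $\|v-\widetilde c\|_\infty=\max_{1\le i\le n}|v_i-\widetilde c|$.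
   Formalization: The constant c̃ may depend on n (it stays deterministic). A single c̃ for all n is impossible in general: for α_n=1, θ(0,x)=x/10, the mean phase is conserved, so the limit is (n−1)/(20n), which varies with n. *)

(* Defs.v *)
From HB Require Import structures.
From mathcomp Require Import all_boot all_order all_algebra.
From mathcomp Require Import all_classical all_reals all_analysis.

Set Implicit Arguments.
Unset Strict Implicit.
Unset Printing Implicit Defensive.

Import Order.TTheory GRing.Theory Num.Theory.
Import numFieldNormedType.Exports.

Local Open Scope classical_set_scope.
Local Open Scope ring_scope.

(* u' = g on [0, +oo[ : the derivative is taken at the interior points and u is
   continuous up to t = 0, so that u 0 is attached to the trajectory (when g is
   continuous, the one-sided equation at t = 0 follows). *)
Definition solves_ode (R : realType) (u g : R -> R) : Prop :=
  {within `[0, +oo[, continuous u} /\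
  (forall t : R, 0 < t -> is_derive t 1 u (g t)).

(* [theta t x] is only constrained for 0 <= t and x in [0, 1].  Measurability
   in the space variable makes the integrals meaningful. *)
Definition continuum_kuramoto (R : realType) (theta : R -> R -> R) : Prop :=
  (forall t : R, 0 <= t -> measurable_fun (`[0, 1] : set R) (theta t)) /\
  (forall x : R, 0 <= x <= 1 ->
     solves_ode (fun t => theta t x)
       (fun t => \int[lebesgue_measure]_(y in `[0, 1])
                   sin (theta t y - theta t x))).

Definition sampled_kuramoto (R : realType) (n : nat) (alpha : R)
    (A : 'M[R]_n) (theta : R -> 'rV[R]_n) : Prop :=
  forall i : 'I_n,
    solves_ode (fun t => theta t 0 i)
      (fun t => (n%:R * alpha)^-1 *
                \sum_(j < n) A i j * sin (theta t 0 j - theta t 0 i)).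

(* Mutual independence of the subfamily (X i), i in D: the product rule over
   all its subfamilies. *)
Definition mutually_independent (d d' : measure_display)
    (Omega : measurableType d) (T : measurableType d') (R : realType)
    (P : probability Omega R) (I : finType) (D : {set I})
    (X : I -> {mfun Omega >-> T}) : Prop :=
  forall (J : {set I}) (B : I -> set T), J \subset D ->
    (forall i, measurable (B i)) ->
    P (\bigcap_(i in [set` J]) (X i @^-1` B i)) =
    (\prod_(i in J) P (X i @^-1` B i))%E.

(* The diagonal entries are random too, as in the model with i <= j. *)
Definition erdos_renyi (d : measure_display) (Omega : measurableType d)
    (R : realType) (P : probability Omega R) (n : nat) (p : R)
    (A : 'I_n -> 'I_n -> {mfun Omega >-> bool}) : Prop :=
  [/\ forall i j w, A i j w = A j i w,
      forall i j, distribution P (A i j) =1 bernoulli_prob p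
    & mutually_independent P
        [set ij : 'I_n * 'I_n | (ij.1 <= ij.2)%N]%SET
        (fun ij => A ij.1 ij.2)].

Definition adjacency_mx (d : measure_display) (Omega : measurableType d)
    (R : realType) (n : nat) (A : 'I_n -> 'I_n -> {mfun Omega >-> bool})
    (w : Omega) : 'M[R]_n :=
  \matrix_(i, j) (A i j w)%:R.

(* The L^oo([0, 1]) norm: extending by 0 outside [0, 1] does not change it. *)
Definition Linfty01_norm (R : realType) (u : R -> R) : \bar R :=
  'N[@lebesgue_measure R]_+oo%E[EFin \o (u \_ (`[0%R, 1%R] : set R))]%E.

(* Main.v *)
Require Import Defs.
From HB Require Import structures.
From mathcomp Require Import all_boot all_order all_algebra.
From mathcomp Require Import all_classical all_reals all_analysis.
From mathcomp Require Import ring lra.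

Set Implicit Arguments.
Unset Strict Implicit.
Unset Printing Implicit Defensive.

Import Order.TTheory GRing.Theory Num.Theory.
Import numFieldNormedType.Exports.

Local Open Scope classical_set_scope.
Local Open Scope ring_scope.

(** The proof compares the random system with the continuum model up to a
    fixed time, and then lets the random system synchronize by itself.

    Since the continuum model synchronizes, at some time T all its phases lie
    in a short arc around c ([sync_time]; the essential supremum bound holds
    everywhere because [theta T] is continuous in space).  On [0, T] the
    sampled system stays uniformly close to the continuum model
    ([coupled_near_reference]): in the equation for the difference, the
    coupling is Lipschitz because degrees are at most 2 n alpha, replacing the
    adjacency matrix by its mean alpha costs a small multiple of n alpha, and
    the averages over the points i / n approximate the space integrals
    ([mean_field_riemann]).  The first two points say that finitely many
    deterministic linear functionals of the rows of the adjacency matrix are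
    close to their means, for each row and each time in a finite grid; the
    phases are 1-Lipschitz in time, so the grid controls all times.  Each of
    these functionals deviates with probability at most
    exp (- e ^ 2 n alpha / 8) by a Chernoff bound ([row_tail]), which beats the
    union over the rows because n alpha / ln n tends to infinity.

    At time T the phases of the sampled system therefore lie in an arc so
    short that x * sin x >= x ^ 2 / 2 on differences of phases.  Such an arc is
    never left ([arc_invariant]), the mean phase is conserved by symmetry of
    the adjacency matrix, and on a connected graph the variance decays
    exponentially ([coupled_variance_decay]); so all phases converge to the
    mean of the initial phases, which is the constant [ctilde n].  Connectivity
    has high probability by a union bound over cuts
    ([disconnected_probability]).

    The synchronization event is measurable because, by uniqueness of
    solutions ([coupled_unique]), it depends on the sample point only through
    the adjacency matrix, which takes finitely many values. *)

(** * First exit times and a sup-norm Gronwall inequality *)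

Lemma within_continuous_comp (R : realType) (A : set R) (f g : R -> R) :
  {within A, continuous f} -> continuous g ->
  {within A, continuous (fun x => g (f x))}.
Proof.
by move=> fc gc x; apply: (@continuous_comp (subspace A) R R f g);
  [exact: fc|exact: gc].
Qed.

Lemma within_continuousB (R : realType) (A : set R) (f g : R -> R) :
  {within A, continuous f} -> {within A, continuous g} ->
  {within A, continuous (fun x => f x - g x)}.
Proof. by move=> fc gc x; apply: continuousB; [exact: fc|exact: gc]. Qed.

Lemma within_continuousM (R : realType) (A : set R) (f g : R -> R) :
  {within A, continuous f} -> {within A, continuous g} ->
  {within A, continuous (fun x => f x * g x)}.
Proof. by move=> fc gc x; apply: continuousM; [exact: fc|exact: gc]. Qed.

Lemma within_continuous_sum (R : realType) (A : set R) (n : nat)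
    (f : 'I_n -> R -> R) :
  (forall i, {within A, continuous (f i)}) ->
  {within A, continuous (fun x => \sum_(i < n) f i x)}.
Proof.
move=> fc; rewrite (_ : (fun x => _) = \sum_(i < n) f i); last first.
  by apply/funext => x; rewrite fct_sumE.
elim/big_ind : _ => [|g h gc hc|i _]; last exact: fc.
  by apply: continuous_subspaceT; exact: cst_continuous.
by move=> x; apply: continuousD; [exact: gc|exact: hc].
Qed.

Lemma derive_le0_le (R : realType) (a b : R) (f f' : R -> R) :
  a <= b -> {within `[a, b], continuous f} ->
  (forall t : R, a < t < b -> is_derive t 1 f (f' t)) ->
  (forall t : R, a < t < b -> f' t <= 0) -> f b <= f a.
Proof.
move=> ab fc fd f'0.
have [<-//|anb] := eqVneq a b.
have {}ab : a < b by rewrite lt_neqAle anb.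
have fd' x : x \in `]a, b[%R -> is_derive x 1 f (f' x).
  by rewrite in_itv; exact: fd.
have [x xab E] := MVT ab fd' fc.
rewrite -subr_le0 E mulr_le0_ge0 ?subr_ge0 ?(ltW ab)//.
by apply: f'0; move: xab; rewrite in_itv.
Qed.

(** At the infimum of the times at which some [h i] is nonnegative, all of them
    are negative (by the initial condition or by the step hypothesis), hence,
    there being finitely many, they remain negative a little longer. Every
    argument below that bootstraps an a priori bound goes through this lemma. *)
Lemma first_exit (R : realType) (I : finType) (a b : R) (h : I -> R -> R) :
  (forall i, {within `[a, b], continuous (h i)}) ->
  (forall i, h i a < 0) ->
  (forall t, a < t <= b -> (forall s i, a <= s < t -> h i s < 0) ->
     forall i, h i t < 0) ->
  forall t i, a <= t <= b -> h i t < 0.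
Proof.
move=> hc ha step t0 i0 t0ab; rewrite ltNge; apply/negP => h0.
pose S : set R := [set t | a <= t <= b /\ exists i, 0 <= h i t].
have St0 : S t0 by split=> //; exists i0.
have lbS : lbound S a by move=> x [/andP[]].
have hS : has_inf S by split; [exists t0|exists a].
have [as_ st] : a <= inf S /\ inf S <= t0.
  by split; [apply: lb_le_inf => //; exists t0|apply: ge_inf => //; exists a].
set s := inf S in as_ st.
have sab : a <= s <= b by rewrite as_ (le_trans st)//; case/andP: t0ab.
have before u i : a <= u < s -> h i u < 0.
  move=> /andP[au us]; rewrite ltNge; apply/negP => hu.
  have : s <= u.
    apply: ge_inf; first by exists a.
    split; last by exists i.
    by rewrite au/= (le_trans (ltW us))//; case/andP: sab.
  by rewrite leNgt us.
have hs i : h i s < 0.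
  have [<-//|ans] := eqVneq a s.
  by apply: step => //; case/andP: sab => ? ->; rewrite lt_neqAle ans as_.
have : \forall u \near within `[a, b] (nbhs s), forall i, h i u < 0.
  apply: filter_forall => i.
  have /subspace_continuousP/(_ s) := hc i.
  rewrite /= in_itv /= => /(_ sab) /cvgr_lt; apply; exact: hs.
move=> /nbhs_ballP[e/= e0 se].
have [u Su us] := inf_adherent e0 hS.
have su : s <= u by apply: ge_inf => //; exists a.
case: Su => uab [i]; rewrite leNgt => /negP; apply.
apply: (se u); last by rewrite /= in_itv.
by rewrite /ball/= ler0_norm ?subr_le0// opprB ltrBlDr addrC.
Qed.

(** Gronwall's inequality for a maximum, which need not be differentiable: the
    barrier [K * expR ((L + 1) * t)] grows at least as fast as any [e i] can as
    long as all of them are below it; since they start strictly below, there is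
    no first time at which one of them reaches it. *)
Lemma sup_gronwall (R : realType) (I : finType) (e g : I -> R -> R)
    (T L eta K : R) :
  0 <= L -> eta <= K -> 0 < K ->
  (forall i, {within `[0, T], continuous (e i)}) ->
  (forall i (t : R), 0 < t < T -> is_derive t 1 (e i) (g i t)) ->
  (forall i (t B : R), 0 < t < T -> (forall j, `|e j t| <= B) ->
     `|g i t| <= L * B + eta) ->
  (forall i, `|e i 0| < K) ->
  forall t i, 0 <= t <= T -> `|e i t| < K * expR ((L + 1) * t).
Proof.
move=> L0 etaK K0 ec ed eg e0.
pose psi t : R := K * expR ((L + 1) * t).
have psid (t : R) : is_derive t 1 psi ((L + 1) * psi t).
  rewrite /psi; apply: is_derive_eq.
  by rewrite /GRing.scale/= !(mulr0,addr0,mulr1,add0r,scaler0); ring.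
have psic : continuous psi.
  by move=> t; apply/differentiable_continuous/derivable1_diffP; have [] := psid t.
suff H t i : 0 <= t <= T -> `|e i t| - psi t < 0.
  by move=> t i tT; rewrite -subr_lt0; exact: H.
move: t i; apply: first_exit => [i|i|t /andP[t0 tT] IH i].
- apply: within_continuousB; last exact: continuous_subspaceT.
  by apply: within_continuous_comp (ec i) _; exact: norm_continuous.
- by rewrite /psi mulr0 expR0 mulr1 subr_lt0.
have ect : {within `[0, t], continuous (e i)}.
  apply: continuous_subspaceW (ec i).
  by apply: subset_itvl; rewrite bnd_simp.
have gb (s : R) : 0 < s < t -> `|g i s| <= (L + 1) * psi s.
  move=> /andP[s0 st].
  have psiK : K <= psi s.
    by rewrite /psi ler_peMr ?(ltW K0)// -expR0 ler_expR mulr_ge0 ?addr_ge0// ltW.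
  apply: (@le_trans _ _ (L * psi s + eta)).
    apply: eg; first by rewrite s0 (lt_le_trans st).
    by move=> j; have := IH s j; rewrite ltW//= st subr_lt0 => /(_ isT)/ltW.
  by rewrite mulrDl mul1r lerD2l (le_trans etaK).
have e0i := e0 i; have psi0 : psi 0 = K by rewrite /psi mulr0 expR0 mulr1.
have Hp : e i t - psi t <= e i 0 - psi 0.
  apply: (@derive_le0_le _ 0 t (fun s => e i s - psi s)
                        (fun s => g i s - (L + 1) * psi s)) => [||s st|s st].
  - exact: ltW.
  - by apply: within_continuousB => //; exact: continuous_subspaceT.
  - have := ed i s; case/andP: st => -> st; rewrite (lt_le_trans st tT) => /(_ isT) ?.
    exact: is_deriveB.
  - by rewrite subr_le0 (le_trans (ler_norm _))// gb.
have Hm : - e i t - psi t <= - e i 0 - psi 0.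
  apply: (@derive_le0_le _ 0 t (fun s => - e i s - psi s)
                        (fun s => - g i s - (L + 1) * psi s)) => [||s st|s st].
  - exact: ltW.
  - apply: within_continuousB; last exact: continuous_subspaceT.
    by apply: within_continuous_comp ect _; exact: oppr_continuous.
  - have := ed i s; case/andP: st => -> st; rewrite (lt_le_trans st tT) => /(_ isT) ?.
    by apply: is_deriveB.
  - by rewrite subr_le0 (le_trans (ler_norm _))// normrN gb.
rewrite subr_lt0 ltr_norml; move: e0i; rewrite ltr_norml -psi0 => /andP[? ?].
by apply/andP; split; lra.
Qed.

(** * Sine coupling on a graph: pairing identity and Lyapunov functions *)

Lemma sin_lipschitz (R : realType) (x y : R) : `|sin x - sin y| <= `|x - y|.
Proof.
wlog xy : x y / x <= y => [hw|].
  by have [/hw//|/ltW/hw] := leP x y; rewrite distrC [leRHS]distrC.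
have [c _ E] : exists2 c, c \in `[x, y] & sin y - sin x = cos c * (y - x).
  apply: (MVT_segment xy) => //.
  exact/continuous_subspaceT/continuous_sin.
rewrite distrC [leRHS]distrC E normrM ler_piMl// ler_norml.
by rewrite cos_geN1 cos_le1.
Qed.

(** The quadratic lower bound on [x * sin x] makes the coupling dissipative for
    phases in a short arc; any radius will do, so it comes from the continuity
    of the cosine at 0. *)
Lemma sin_ge_half_near0 (R : realType) :
  exists2 r : R, 0 < r & forall x : R, `|x| <= r -> x ^+ 2 / 2 <= x * sin x.
Proof.
have : cos x @[x --> (0 : R)] --> (1 : R).
  by rewrite -[X in _ --> X]cos0; exact: continuous_cos.
move=> /cvgr_gt/(_ (2^-1) _); rewrite invf_lt1 ?ltr1n// => /(_ isT).
move=> /nbhs_ballP[e/= e0 he].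
exists (e / 2); first by rewrite divr_gt0.
have pos x : 0 <= x <= e / 2 -> x / 2 <= sin x.
  move=> /andP[x0 xe].
  have [||c cx E] := @MVT_segment R (fun z => sin z - z / 2) (fun z => cos z - 1 / 2) 0 x x0.
  - by move=> z _; apply: is_derive_eq; rewrite /GRing.scale/=; field.
  - apply: within_continuousB; apply: continuous_subspaceT; first exact: continuous_sin.
    exact: mulrr_continuous.
  have : 0 <= cos c - 1 / 2.
    rewrite subr_ge0 mul1r ltW//; apply: he; rewrite /ball/= sub0r normrN.
    move: cx; rewrite in_itv/= => /andP[c0 cx]; rewrite ger0_norm//.
    by rewrite (le_lt_trans cx)// (le_lt_trans xe)// ltr_pdivrMr// ltr_pMr// ltr1n.
  move=> /(mulr_ge0)/(_ (_ : 0 <= x - 0)); rewrite subr0 => /(_ x0).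
  by rewrite -[X in _ * X]subr0 -E sin0 mul0r !subr0 subr_ge0.
move=> x xr; have [x0|x0] := leP 0 x.
  rewrite expr2 -mulrA ler_wpM2l// pos// x0/=.
  by rewrite -[x]ger0_norm.
rewrite -[x * sin x]mulrNN -sinN -sqrrN expr2 -mulrA ler_wpM2l ?oppr_ge0 ?(ltW x0)//.
by apply: pos; rewrite oppr_ge0 (ltW x0)/= -ltr0_norm.
Qed.

Definition coupling (R : realType) (n : nat) (k : R) (a : rel 'I_n)
    (v : 'I_n -> R) (i : 'I_n) : R :=
  k * \sum_(j < n) (a i j)%:R * sin (v j - v i).

Definition coupled_on (R : realType) (n : nat) (k : R) (a : rel 'I_n)
    (T S : R) (u : 'I_n -> R -> R) : Prop :=
  (forall i, {within `[T, S], continuous (u i)}) /\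
  (forall i (t : R), T < t < S ->
     is_derive t 1 (u i) (coupling k a (fun j => u j t) i)).

(** Summation by parts on the graph: the adjacency relation is symmetric and the
    sine is odd, so exchanging the two ends of every edge antisymmetrizes [F].
    With [F] constant it yields the conservation of the mean, with [F]
    nondecreasing the decay of convex functionals. *)
Lemma coupling_pairing (R : realType) (n : nat) (k : R) (a : rel 'I_n)
    (v F : 'I_n -> R) : symmetric a ->
  \sum_(i < n) F i * coupling k a v i =
  - (k / 2) * \sum_(i < n) \sum_(j < n)
      (a i j)%:R * ((F i - F j) * sin (v i - v j)).
Proof.
move=> syma.
pose G i j := (a i j)%:R * (F i * sin (v i - v j)).
have E1 : \sum_(i < n) F i * coupling k a v i =
          - k * \sum_(i < n) \sum_(j < n) G i j.
  rewrite mulr_sumr; apply: eq_bigr => i _.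
  rewrite /coupling mulrCA mulNr -mulrN -sumrN mulr_sumr; congr (_ * _).
  by apply: eq_bigr => j _; rewrite /G -[v j - v i]opprB sinN; ring.
have E2 : \sum_(i < n) \sum_(j < n) (a i j)%:R * ((F i - F j) * sin (v i - v j))
          = 2 * \sum_(i < n) \sum_(j < n) G i j.
  transitivity (\sum_(i < n) \sum_(j < n) (G i j + G j i)).
    apply: eq_bigr => i _; apply: eq_bigr => j _.
    by rewrite /G [a j i]syma -[v j - v i]opprB sinN; ring.
  under eq_bigr do rewrite big_split.
  by rewrite big_split/= [X in _ + X]exchange_big/=; ring.
by rewrite E1 E2; field.
Qed.

Lemma is_derive_sum_coupled (R : realType) (n : nat) (k : R) (a : rel 'I_n)
    (T S : R) (u : 'I_n -> R -> R) (F F' : R -> R) (t : R) :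
  coupled_on k a T S u -> T < t < S ->
  (forall x : R, is_derive x 1 F (F' x)) ->
  is_derive t 1 (fun s => \sum_(i < n) F (u i s))
    (\sum_(i < n) F' (u i t) * coupling k a (fun j => u j t) i).
Proof.
move=> [_ ud] tTS Fd.
rewrite (_ : (fun s => _) = \sum_(i < n) (F \o u i)); last first.
  by apply/funext => s; rewrite fct_sumE.
apply: is_derive_sum => i.
by apply: is_derive1_comp; exact: ud.
Qed.

Lemma sum_coupled_const (R : realType) (n : nat) (k : R) (a : rel 'I_n)
    (T S : R) (u : 'I_n -> R -> R) :
  symmetric a -> T <= S -> coupled_on k a T S u ->
  \sum_(i < n) u i S = \sum_(i < n) u i T.
Proof.
move=> syma TS uk.
have drv (t : R) : T < t < S -> is_derive t 1 (fun s => \sum_(i < n) u i s) 0.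
  move=> tTS.
  have := @is_derive_sum_coupled _ _ _ _ _ _ _ id (fun=> 1) t uk tTS.
  move=> /(_ (fun x => is_derive_id x 1)) d.
  apply: is_derive_eq; rewrite (coupling_pairing k _ (fun=> 1) syma).
  by rewrite big1 ?mulr0// => i _; rewrite big1// => j _; rewrite subrr mul0r mulr0.
have uc : {within `[T, S], continuous (fun s => \sum_(i < n) u i s)}.
  exact/within_continuous_sum/(proj1 uk).
have [c _ E] : exists2 c, c \in `[T, S] & \sum_(i < n) u i S - \sum_(i < n) u i T = 0 * (S - T).
  by apply: (MVT_segment TS _ uc) => t; rewrite in_itv/=; exact: drv.
by apply/eqP; rewrite -subr_eq0 E mul0r.
Qed.

(** Every sum of a convex function of the phases is a Lyapunov function as long
    as the phases stay in a short arc. *)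
Lemma sum_coupled_le (R : realType) (n : nat) (k : R) (a : rel 'I_n)
    (T S r : R) (u : 'I_n -> R -> R) (F F' : R -> R) :
  0 <= k -> symmetric a -> T <= S -> coupled_on k a T S u ->
  (forall x : R, is_derive x 1 F (F' x)) -> {homo F' : x y / x <= y} ->
  (forall x : R, `|x| <= r -> x ^+ 2 / 2 <= x * sin x) ->
  (forall t i j, T < t < S -> `|u i t - u j t| <= r) ->
  \sum_(i < n) F (u i S) <= \sum_(i < n) F (u i T).
Proof.
move=> k0 syma TS uk Fd Fm hr ur.
apply: (@derive_le0_le _ T S (fun s => \sum_(i < n) F (u i s)) _ TS).
- apply: within_continuous_sum => i; apply: within_continuous_comp; first exact: (proj1 uk).
  by move=> x; apply/differentiable_continuous/derivable1_diffP; have [] := Fd x.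
- by move=> t tTS; exact: (is_derive_sum_coupled uk tTS Fd).
move=> t tTS /=.
rewrite (coupling_pairing k _ (fun i => F' (u i t)) syma) mulNr oppr_le0.
rewrite mulr_ge0 ?divr_ge0//; apply: sumr_ge0 => i _; apply: sumr_ge0 => j _.
apply: mulr_ge0 => //.
have := hr _ (ur t i j tTS); set x := u i t - u j t => hx.
have {}hx : 0 <= x * sin x by apply: le_trans hx; rewrite divr_ge0 ?sqr_ge0.
have [ij|ij] := leP (u j t) (u i t).
  have x0 : 0 <= x by rewrite subr_ge0.
  apply: mulr_ge0; first by rewrite subr_ge0 Fm.
  move: x0; rewrite le_eqVlt => /predU1P[<-|x0]; first by rewrite sin0.
  by rewrite -(pmulr_rge0 _ x0).
have x0 : x < 0 by rewrite subr_lt0.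
by rewrite mulr_le0 ?subr_le0 ?Fm// ?(ltW ij)// -(nmulr_rge0 _ x0).
Qed.

(** * Arcs are invariant, and the variance decays on a connected graph *)

(** A sum of convex functions only bounds the maximum up to a factor n, so a
    fixed convex function such as the square would not keep the phases in the
    arc. The function [expR (K * x) + expR (- (K * x))] with [K] large compared
    to n does: it approximates the maximum well enough to absorb the factor. *)
Lemma arc_invariant (R : realType) (n : nat) (k : R) (a : rel 'I_n)
    (T S r0 r1 c : R) (u : 'I_n -> R -> R) :
  0 <= k -> symmetric a -> coupled_on k a T S u -> r0 < r1 ->
  (forall x : R, `|x| <= 2 * r1 -> x ^+ 2 / 2 <= x * sin x) ->
  (forall i, `|u i T - c| <= r0) ->
  forall t i, T <= t <= S -> `|u i t - c| < r1.
Proof.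
move=> k0 syma uk r01 hr u0.
suff H t i : T <= t <= S -> `|u i t - c| - r1 < 0.
  by move=> t i tT; rewrite -subr_lt0; exact: H.
move: t i; apply: first_exit => [i|i|t /andP[Tt tS] IH i].
- apply: (@within_continuous_comp _ _ (u i) (fun x => `|x - c| - r1)); first exact: (proj1 uk).
  move=> x; apply: (@continuousB _ _ _ (fun x => `|x - c|) (cst r1)).
    apply: (@continuous_comp _ _ _ (fun x => x - c) (fun x => `|x|)).
      by apply: (@continuousB _ _ _ id (cst c)); [exact: id|exact: cst_continuous].
    exact: norm_continuous.
  exact: cst_continuous.
- by rewrite subr_lt0 (le_lt_trans (u0 i)).
have K0 : 0 < r1 - r0 by rewrite subr_gt0.
(* With this K, expR (K * r1) = expR (2 n) * expR (K * r0) exceeds the initial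
   value 2 n * expR (K * r0) of the Lyapunov function. *)
pose K := n%:R *+ 2 / (r1 - r0).
have KE : K * r1 = n%:R *+ 2 + K * r0.
  by rewrite /K; field; rewrite subr_eq0 gt_eqF.
have K_ge0 : 0 <= K by rewrite divr_ge0 ?(ltW K0)// mulrn_wge0.
pose F x : R := expR (K * (x - c)) + expR (- (K * (x - c))).
pose F' x : R := K * (expR (K * (x - c)) - expR (- (K * (x - c)))).
have Fd (x : R) : is_derive x 1 F (F' x).
  rewrite /F /F'; apply: is_derive_eq.
  by rewrite /GRing.scale/=; ring.
have F'm : {homo F' : x y / x <= y}.
  move=> x y xy; rewrite /F' ler_wpM2l// lerB// ler_expR ?lerN2;
  by rewrite ler_wpM2l// lerB.
have FE (x : R) : expR (K * `|x - c|) <= F x.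
  rewrite /F; have [x0|x0] := ger0P (x - c).
    by rewrite lerDl expR_ge0.
  by rewrite mulrN lerDr expR_ge0.
have F0 j : F (u j T) <= expR (K * r0) *+ 2.
  move: (u0 j); rewrite ler_norml => /andP[h1 h2].
  rewrite mulr2n lerD// ler_expR -?mulrN ler_wpM2l//.
  by rewrite lerNl.
have uk' : coupled_on k a T t u.
  split=> [j|j s /andP[Ts st]].
    apply: continuous_subspaceW (proj1 uk j).
    by apply: subset_itvl; rewrite bnd_simp.
  by apply: (proj2 uk); rewrite Ts (lt_le_trans st).
have := sum_coupled_le k0 syma (ltW Tt) uk' Fd F'm hr.
move=> /(_ _) H; rewrite subr_lt0 ltNge; apply/negP => r1u.
have {}H : \sum_(j < n) F (u j t) <= \sum_(j < n) F (u j T).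
  apply: H => s p q /andP[Ts st].
  have h w : `|u w s - c| < r1.
    by rewrite -subr_lt0; apply: IH; rewrite (ltW Ts).
  have -> : u p s - u q s = (u p s - c) - (u q s - c) by ring.
  by rewrite (le_trans (ler_normB _ _))// mulr_natl mulr2n lerD// ltW.
have h1 : expR (K * r1) <= \sum_(j < n) F (u j t).
  apply: (@le_trans _ _ (F (u i t))).
    by apply: le_trans (FE _); rewrite ler_expR ler_wpM2l.
  rewrite (bigD1 i)//= lerDl; apply: sumr_ge0 => j _.
  by rewrite addr_ge0// expR_ge0.
have h2 : \sum_(j < n) F (u j T) <= n%:R * (expR (K * r0) *+ 2).
  rewrite (le_trans (ler_sum _ (fun j _ => F0 j)))//.
  by rewrite sumr_const card_ord mulr_natl.
have := le_trans h1 (le_trans H h2).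
rewrite KE expRD mulrnAr -mulrnAl ler_pM2r ?expR_gt0//.
apply/negP; rewrite -ltNge (lt_le_trans _ (expR_ge1Dx _))//.
by rewrite ltrDr.
Qed.

(** Telescoping along the path. *)
Lemma path_spread (R : realType) (I : eqType) (a : rel I) (v : I -> R) (e : R)
    (i : I) (p : seq I) :
  (forall j l, a j l -> `|v j - v l| <= e) -> path a i p ->
  `|v i - v (last i p)| <= (size p)%:R * e.
Proof.
move=> ae; elim: p i => [|j p IHp] i /=; first by rewrite subrr normr0 mul0r.
move=> /andP[aij /IHp h].
have -> : v i - v (last j p) = (v i - v j) + (v j - v (last j p)) by ring.
by rewrite (le_trans (ler_normD _ _))// -natr1 mulrDl mul1r addrC lerD// ae.
Qed.

(** The constant is far from optimal but only its positivity matters: a simple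
    path has fewer than n edges, so two values differ by at most n times the
    square root of the Dirichlet form. *)
Lemma connected_poincare (R : realType) (n : nat) (a : rel 'I_n)
    (v : 'I_n -> R) (m : R) :
  (forall i j, connect a i j) -> \sum_(i < n) v i = n%:R * m ->
  \sum_(i < n) (v i - m) ^+ 2 <=
  n%:R ^+ 3 * \sum_(i < n) \sum_(j < n) (a i j)%:R * (v i - v j) ^+ 2.
Proof.
move=> conn vm; set Q := \sum_(i < n) \sum_(j < n) _.
have nn_term i j : 0 <= (a i j)%:R * (v i - v j) ^+ 2.
  by rewrite mulr_ge0// sqr_ge0.
have Q0 : 0 <= Q by do 2! (apply: sumr_ge0 => ? _).
have edge i j : a i j -> `|v i - v j| <= Num.sqrt Q.
  move=> aij; rewrite -sqrtr_sqr ler_wsqrtr// /Q (bigD1 i)//= (bigD1 j)//= aij mul1r.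
  by rewrite -addrA lerDl addr_ge0// sumr_ge0// => *; rewrite ?sumr_ge0.
have spread i j : `|v i - v j| <= n%:R * Num.sqrt Q.
  have /connectP[p pth ->] := conn i j.
  have [p' pth' up' _] := shortenP pth.
  rewrite (le_trans (path_spread edge pth'))// ler_wpM2r ?sqrtr_ge0// ler_nat.
  have := card_uniqP up'; rewrite /= => /esym h.
  by rewrite -ltnS h ltnW// ltnS -[X in (_ <= X)%N](card_ord n) max_card.
have dev i : `|v i - m| <= n%:R * Num.sqrt Q.
  have n0 : 0 < n%:R :> R by rewrite ltr0n; case: (n) i => [[]|].
  rewrite -(ler_pM2l n0) -[X in X * `|_|]ger0_norm ?(ltW n0)// -normrM mulrBr -vm.
  have -> : n%:R * v i - \sum_(j < n) v j = \sum_(j < n) (v i - v j).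
    by rewrite sumrB sumr_const card_ord mulr_natl.
  apply: le_trans (ler_norm_sum _ _ _) _.
  apply: le_trans (ler_sum _ (fun j _ => spread i j)) _.
  by rewrite sumr_const card_ord [leRHS]mulr_natl.
apply: (@le_trans _ _ (\sum_(i < n) (n%:R * Num.sqrt Q) ^+ 2)).
  apply: ler_sum => i _; rewrite -[leLHS]ger0_norm ?sqr_ge0// normrX.
  by rewrite lerXn2r// nnegrE mulr_ge0// sqrtr_ge0.
by rewrite sumr_const card_ord exprMn sqr_sqrtr// -[leLHS]mulr_natl mulrA -exprS.
Qed.

(** The derivative of the variance is minus the Dirichlet form of the phases, up
    to constants, by [coupling_pairing] and the lower bound on [x * sin x];
    the Poincare inequality turns it into the variance itself. *)
Lemma coupled_variance_decay (R : realType) (n : nat) (k : R) (a : rel 'I_n)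
    (T S r m : R) (u : 'I_n -> R -> R) :
  (0 < n)%N -> 0 <= k -> symmetric a -> (forall i j, connect a i j) -> T <= S ->
  coupled_on k a T S u ->
  \sum_(i < n) u i T = n%:R * m ->
  (forall x : R, `|x| <= r -> x ^+ 2 / 2 <= x * sin x) ->
  (forall t i j, T <= t <= S -> `|u i t - u j t| <= r) ->
  expR (k / (2 * n%:R ^+ 3) * S) * \sum_(i < n) (u i S - m) ^+ 2 <=
  expR (k / (2 * n%:R ^+ 3) * T) * \sum_(i < n) (u i T - m) ^+ 2.
Proof.
move=> n0 k0 syma conn TS uk um hr ur.
set b := k / (2 * n%:R ^+ 3).
pose V t := \sum_(i < n) (u i t - m) ^+ 2.
pose V' t := \sum_(i < n) (2 * (u i t - m)) * coupling k a (fun j => u j t) i.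
have Vd (t : R) : T < t < S -> is_derive t 1 V (V' t).
  move=> tTS; apply: (@is_derive_sum_coupled _ _ _ _ _ _ _ (fun x => (x - m) ^+ 2)
    (fun x => 2 * (x - m)) _ uk tTS) => x.
  by apply: is_derive_eq; rewrite /GRing.scale/=; ring.
have Vc : {within `[T, S], continuous V}.
  apply: within_continuous_sum => i.
  apply: (@within_continuous_comp _ _ _ (fun x => (x - m) ^+ 2)); first exact: (proj1 uk).
  move=> x; apply/differentiable_continuous/derivable1_diffP.
  by apply: ex_derive.
apply: (@derive_le0_le _ T S (fun t => expR (b * t) * V t)
  (fun t => b * expR (b * t) * V t + expR (b * t) * V' t)) => // [|t tTS|t tTS].
- apply: within_continuousM Vc; apply: continuous_subspaceT => y.
  by apply/differentiable_continuous/derivable1_diffP; apply: ex_derive.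
- have ? := Vd t tTS; apply: is_derive_eq.
  by rewrite /GRing.scale/= /V; ring.
rewrite [b * _]mulrC -mulrA -mulrDr pmulr_rle0 ?expR_gt0//.
have tTS' : T <= t <= S by case/andP: tTS => /ltW -> /ltW ->.
have mt : \sum_(i < n) u i t = n%:R * m.
  rewrite -um; apply: (sum_coupled_const syma); first by case/andP: tTS'.
  split=> [j|j s /andP[Ts st]].
    apply: continuous_subspaceW (proj1 uk j).
    by apply: subset_itvl; rewrite bnd_simp; case/andP: tTS'.
  by apply: (proj2 uk); rewrite Ts (lt_le_trans st)//; case/andP: tTS'.
have := connected_poincare conn mt.
rewrite -/(V t); set Q := \sum_(i < n) \sum_(j < n) _ => PQ.
rewrite /V' (coupling_pairing k _ _ syma).
set Q' := (X in - (k / 2) * X).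
have QQ' : Q <= Q'.
  apply: ler_sum => i _; apply: ler_sum => j _; rewrite ler_wpM2l//.
  have -> : 2 * (u i t - m) - 2 * (u j t - m) = 2 * (u i t - u j t) by ring.
  by have := hr _ (ur t i j tTS'); lra.
have n3 : 0 < n%:R ^+ 3 :> R by rewrite exprn_gt0// ltr0n.
have : b * V t <= k / 2 * Q.
  apply: (@le_trans _ _ (b * (n%:R ^+ 3 * Q))).
    by rewrite ler_wpM2l// /b divr_ge0// mulr_ge0// ltW.
  rewrite le_eqVlt; apply/orP; left; apply/eqP; rewrite /b.
  by field; rewrite gt_eqF// ltr0n.
have : k / 2 * Q <= k / 2 * Q' by rewrite ler_wpM2l// divr_ge0.
by rewrite mulNr; lra.
Qed.

(** * Synchronization, uniqueness and comparison with a reference trajectory *)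

Lemma connected_arc_sync (R : realType) (n : nat) (k : R) (a : rel 'I_n)
    (T r0 r1 c m : R) (u : 'I_n -> R -> R) :
  (0 < n)%N -> 0 < k -> symmetric a -> (forall i j, connect a i j) -> 0 <= T ->
  (forall S, coupled_on k a 0 S u) ->
  \sum_(i < n) u i 0 = n%:R * m ->
  r0 < r1 -> (forall x : R, `|x| <= 2 * r1 -> x ^+ 2 / 2 <= x * sin x) ->
  (forall i, `|u i T - c| <= r0) ->
  forall e, 0 < e -> exists t1, forall t i, t1 <= t -> `|u i t - m| < e.
Proof.
move=> n0 k0 syma conn T0 uk um r01 hr u0 e e0.
have n3 : 0 < n%:R ^+ 3 :> R by rewrite exprn_gt0// ltr0n.
pose b := k / (2 * n%:R ^+ 3); have b0 : 0 < b by rewrite divr_gt0// mulr_gt0.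
pose V t := \sum_(i < n) (u i t - m) ^+ 2.
have V0 t : 0 <= V t by apply: sumr_ge0 => i _; exact: sqr_ge0.
have e20 : 0 < e ^+ 2 by rewrite exprn_gt0.
(* From 1 + y <= expR y, the variance is below e ^+ 2 once b * (t - T) is at
   least V T / e ^+ 2. *)
exists (T + V T / (e ^+ 2 * b)) => t i ht.
have Tt : T <= t.
  by apply: le_trans ht; rewrite lerDl divr_ge0// mulr_ge0// ltW.
have ukT : coupled_on k a T t u.
  split=> [j|j s /andP[Ts st]].
    apply: continuous_subspaceW (proj1 (uk t) j).
    by apply: subset_itvr; rewrite bnd_simp.
  by apply: (proj2 (uk t)); rewrite st (le_lt_trans T0).
have arc s j : T <= s <= t -> `|u j s - c| < r1.
  by apply: (arc_invariant (ltW k0) syma ukT r01 hr).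
have umT : \sum_(j < n) u j T = n%:R * m.
  by rewrite -um; exact: (sum_coupled_const syma T0 (uk T)).
have dec := coupled_variance_decay n0 (ltW k0) syma conn Tt ukT umT hr.
have {dec} : expR (b * t) * V t <= expR (b * T) * V T.
  apply: dec => s p q sT.
  have -> : u p s - u q s = (u p s - c) - (u q s - c) by ring.
  by rewrite (le_trans (ler_normB _ _))// mulr_natl mulr2n lerD// ltW// arc.
have -> : b * t = b * T + b * (t - T) by ring.
rewrite expRD -mulrA ler_pM2l ?expR_gt0// => dec.
have big : V T / e ^+ 2 < expR (b * (t - T)).
  rewrite (lt_le_trans _ (expR_ge1Dx _))// (@le_lt_trans _ _ (b * (t - T)))//.
    have -> : V T / e ^+ 2 = b * (V T / (e ^+ 2 * b)).
      by field; rewrite !gt_eqF.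
    by rewrite ler_pM2l// lerBrDr addrC.
  by rewrite ltrDr.
have Ve : V t < e ^+ 2.
  rewrite -(ltr_pM2l (expR_gt0 (b * (t - T)))) (le_lt_trans dec)//.
  by rewrite -ltr_pdivrMr.
have : (u i t - m) ^+ 2 < e ^+ 2.
  apply: le_lt_trans Ve; rewrite /V (bigD1 i)//= lerDl.
  by apply: sumr_ge0 => j _; exact: sqr_ge0.
by rewrite -real_normK ?num_real// ltr_pXn2r// nnegrE// ltW.
Qed.

(** The Lipschitz constant in the sup norm is the degree, which is where the
    degree bounds of a typical graph enter. *)
Lemma coupling_lipschitz (R : realType) (n : nat) (k B : R) (a : rel 'I_n)
    (v w : 'I_n -> R) (i : 'I_n) :
  0 <= k -> (forall j, `|v j - w j| <= B) ->
  `|coupling k a v i - coupling k a w i| <=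
  k * (\sum_(j < n) (a i j)%:R) * (2 * B).
Proof.
move=> k0 vw; rewrite /coupling -mulrBr normrM ger0_norm// -mulrA ler_wpM2l//.
rewrite -sumrB mulr_suml; apply: le_trans (ler_norm_sum _ _ _) _.
apply: ler_sum => j _; rewrite -mulrBr normrM ger0_norm// ler_wpM2l//.
apply: le_trans (sin_lipschitz _ _) _.
have -> : v j - v i - (w j - w i) = (v j - w j) - (v i - w i) by ring.
by apply: le_trans (ler_normB _ _) _; rewrite mulr_natl mulr2n lerD.
Qed.

Lemma coupled_unique (R : realType) (n : nat) (k : R) (a : rel 'I_n) (T : R)
    (u v : 'I_n -> R -> R) :
  0 <= k -> coupled_on k a 0 T u -> coupled_on k a 0 T v ->
  (forall i, u i 0 = v i 0) -> forall t i, 0 <= t <= T -> u i t = v i t.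
Proof.
move=> k0 [uc ud] [vc vd] uv0 t i tT.
pose L := k * n%:R * 2; have L0 : 0 <= L by rewrite !mulr_ge0.
apply/eqP; rewrite -subr_eq0 -normr_le0; apply/ler_addgt0Pr => e e0.
(* Two solutions start at distance 0, below any barrier, so K is free. *)
rewrite add0r; pose K := e / expR ((L + 1) * t).
have K0 : 0 < K by rewrite divr_gt0// expR_gt0.
have -> : e = K * expR ((L + 1) * t) by rewrite /K mulfVK// gt_eqF// expR_gt0.
apply/ltW.
apply: (@sup_gronwall R _ (fun i s => u i s - v i s)
  (fun i s => coupling k a (fun j => u j s) i - coupling k a (fun j => v j s) i)
  T L 0 K) => //.
- exact: ltW.
- by move=> j; exact: within_continuousB.
- move=> j s sT; have ? := ud j s sT; have ? := vd j s sT; exact: is_deriveB.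
- move=> j s B sT dB; have B0 : 0 <= B by apply: le_trans (dB j).
  rewrite addr0; apply: le_trans (coupling_lipschitz a j k0 dB) _.
  rewrite /L -mulrA -[leRHS]mulrA -mulrA ler_wpM2l//.
  rewrite ler_wpM2r ?mulr_ge0//.
  rewrite -[in leRHS](card_ord n) -sumr_const; apply: ler_sum => l _.
  by rewrite -[X in _ <= X]/(1%:R) ler_nat leq_b1.
- by move=> j; rewrite uv0 subrr normr0.
Qed.

(** The error in the velocity splits into four terms: the Lipschitz term, the
    consistency error [e1] of the uniform average, the fluctuation [e2] of the
    weights [a i j] around [al] at a grid time, and the cost of moving to the
    nearest grid time, where the phases differ by at most [h]. *)
Lemma coupled_near_reference (R : realType) (n N : nat) (al T e1 e2 h : R)
    (a : rel 'I_n) (u phi g : 'I_n -> R -> R) (tm : 'I_N -> R) :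
  (0 < n)%N -> 0 < al -> 0 <= h -> 0 < e1 + e2 + 6 * h ->
  coupled_on (n%:R * al)^-1 a 0 T u ->
  (forall i, u i 0 = phi i 0) ->
  (forall i, {within `[0, T], continuous (phi i)}) ->
  (forall i (t : R), 0 < t < T -> is_derive t 1 (phi i) (g i t)) ->
  (forall i (t : R), 0 < t < T ->
     `|n%:R^-1 * \sum_(j < n) sin (phi j t - phi i t) - g i t| <= e1) ->
  (forall t : R, 0 < t < T -> exists s, forall j, `|phi j t - phi j (tm s)| <= h) ->
  (forall i, \sum_(j < n) (a i j)%:R <= 2 * (n%:R * al)) ->
  (forall i s,
     `|\sum_(j < n) ((a i j)%:R - al) * sin (phi j (tm s) - phi i (tm s))| <=
     e2 * (n%:R * al)) ->
  forall t i, 0 <= t <= T ->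
    `|u i t - phi i t| < (e1 + e2 + 6 * h) * expR (5 * t).
Proof.
move=> n0 al0 h0 K0 [uc ud] u0 phic phid phig grid deg conc.
have na0 : 0 < n%:R * al by rewrite mulr_gt0// ltr0n.
have n0R : n%:R != 0 :> R by rewrite gt_eqF// ltr0n.
set k := (n%:R * al)^-1 in ud *; have k0 : 0 < k by rewrite invr_gt0.
have kna : k * (n%:R * al) = 1 by rewrite /k mulVf ?gt_eqF.
(* 4 = 2 * 2: degrees up to 2 n al, and two phases in each sine. *)
have -> : 5 = 4 + 1 :> R by ring.
apply: (@sup_gronwall R _ (fun i s => u i s - phi i s)
  (fun i s => coupling k a (fun j => u j s) i - g i s)
  T 4 (e1 + e2 + 6 * h)) => //.
- by move=> j; exact: within_continuousB.
- move=> j s sT; have ? := ud j s sT; have ? := phid j s sT; exact: is_deriveB.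
- move=> i s B sT dB; have B0 : 0 <= B by apply: le_trans (dB i).
  have [p hp] := grid s sT.
  pose D j := sin (phi j s - phi i s) - sin (phi j (tm p) - phi i (tm p)).
  have Dh j : `|D j| <= 2 * h.
    apply: le_trans (sin_lipschitz _ _) _.
    have -> : phi j s - phi i s - (phi j (tm p) - phi i (tm p)) =
      (phi j s - phi j (tm p)) - (phi i s - phi i (tm p)) by ring.
    by apply: le_trans (ler_normB _ _) _; rewrite mulr_natl mulr2n lerD.
  have -> : coupling k a (fun j => u j s) i - g i s =
    (coupling k a (fun j => u j s) i - coupling k a (fun j => phi j s) i)
    + (n%:R^-1 * \sum_(j < n) sin (phi j s - phi i s) - g i s)
    + k * (\sum_(j < n) ((a i j)%:R - al) * sin (phi j (tm p) - phi i (tm p)))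
    + k * (\sum_(j < n) ((a i j)%:R - al) * D j).
    have E : coupling k a (fun j => phi j s) i =
      n%:R^-1 * (\sum_(j < n) sin (phi j s - phi i s))
      + k * (\sum_(j < n) ((a i j)%:R - al) * sin (phi j (tm p) - phi i (tm p)))
      + k * (\sum_(j < n) ((a i j)%:R - al) * D j).
      have -> : n%:R^-1 = k * al :> R by rewrite /k; field; rewrite n0R gt_eqF.
      rewrite -mulrA -!mulrDr /coupling; congr (_ * _).
      rewrite mulr_sumr -!big_split/=; apply: eq_bigr => j _.
      by rewrite /D; ring.
    by rewrite E; ring.
  have b1 := coupling_lipschitz a i (ltW k0) dB.
  have b2 : k * (\sum_(j < n) (a i j)%:R) * (2 * B) <= 4 * B.
    apply: (@le_trans _ _ (k * (2 * (n%:R * al)) * (2 * B))).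
      by rewrite ler_wpM2r ?mulr_ge0// ler_wpM2l// ltW.
    have -> : k * (2 * (n%:R * al)) * (2 * B) = k * (n%:R * al) * (4 * B) by ring.
    by rewrite kna mul1r.
  have b3 := phig i s sT.
  have b4 : `|k * (\sum_(j < n) ((a i j)%:R - al) *
      sin (phi j (tm p) - phi i (tm p)))| <= e2.
    rewrite normrM ger0_norm ?(ltW k0)//.
    apply: (@le_trans _ _ (k * (e2 * (n%:R * al)))).
      by rewrite ler_wpM2l// ltW.
    by rewrite mulrCA kna mulr1.
  have b5 : `|k * (\sum_(j < n) ((a i j)%:R - al) * D j)| <= 6 * h.
    rewrite normrM ger0_norm ?(ltW k0)//.
    apply: (@le_trans _ _ (k * (\sum_(j < n) ((a i j)%:R + al) * (2 * h)))).
      rewrite ler_wpM2l ?(ltW k0)//; apply: le_trans (ler_norm_sum _ _ _) _.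
      apply: ler_sum => j _; rewrite normrM ler_pM//.
      apply: le_trans (ler_normB _ _) _.
      by rewrite !ger0_norm// ltW.
    rewrite -mulr_suml big_split/= sumr_const card_ord -[al *+ n]mulr_natl.
    apply: (@le_trans _ _ (k * ((2 * (n%:R * al) + n%:R * al) * (2 * h)))).
      by rewrite ler_wpM2l ?(ltW k0)// ler_wpM2r ?mulr_ge0// lerD2r.
    have -> : k * ((2 * (n%:R * al) + n%:R * al) * (2 * h))
            = k * (n%:R * al) * (6 * h) by ring.
    by rewrite kna mul1r.
  have tri (x y z v : R) : `|x + y + z + v| <= `|x| + `|y| + `|z| + `|v|.
    apply: le_trans (ler_normD _ _) _; rewrite lerD2r.
    by apply: le_trans (ler_normD _ _) _; rewrite lerD2r ler_normD.
  by apply: le_trans (tri _ _ _ _) _; lra.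
- by move=> i; rewrite u0 subrr normr0.
Qed.

(** * Integrals and continuous functions on an interval *)

(** Centered at a constant v so as to serve both for bounds of integrals (v = 0)
    and for one cell of a Riemann sum (v the value at its left end). *)
Lemma Rintegral_near_cst (R : realType) (D : set (measurableTypeR R))
    (F : R -> R) (v e : R) :
  let mu := @lebesgue_measure R in
  measurable D -> (mu D < +oo)%E -> mu.-integrable D (EFin \o F) ->
  (forall y, D y -> `|F y - v| <= e) ->
  `|\int[mu]_(y in D) F y - v * fine (mu D)| <= e * fine (mu D).
Proof.
move=> mu mD fD iF Fe.
have ic (w : R) : mu.-integrable D (EFin \o cst w).
  by apply: measurable_bounded_integrable => //; exact: bounded_cst.
rewrite -!(Rintegral_cst mu mD) -(RintegralB mD iF (ic v)).
have iFv : mu.-integrable D (EFin \o (fun y => F y - v)).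
  by have := integrableB mD iF (ic v); apply: eq_integrable.
apply: le_trans (le_normr_Rintegral mD iFv) _.
apply: (le_Rintegral mD _ (ic e)) => //.
by have := integrable_norm iFv; apply: eq_integrable.
Qed.

Lemma lebesgue_unit_itv (R : realType) :
  @lebesgue_measure R `[0, 1] = 1%:E.
Proof. by rewrite lebesgue_measure_itv/= lte_fin ltr01 sube0. Qed.

Lemma Rintegral_unit_bound (R : realType) (F : R -> R) (e : R) :
  let mu := @lebesgue_measure R in
  mu.-integrable `[0, 1] (EFin \o F) -> (forall y : R, 0 <= y <= 1 -> `|F y| <= e) ->
  `|\int[mu]_(y in `[0, 1]) F y| <= e.
Proof.
move=> mu iF Fe.
have mu1 : mu `[0, 1]%classic = 1%:E := lebesgue_unit_itv R.
have := @Rintegral_near_cst R `[0, 1]%classic F 0 e (measurable_itv _).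
rewrite -/mu mu1 /= mul0r subr0 mulr1 ltry; apply => // y.
by rewrite /= in_itv/= subr0; exact: Fe.
Qed.

Lemma riemann_sum_error (R : realType) (n : nat) (F : R -> R) (e : R) :
  let mu := @lebesgue_measure R in
  (0 < n)%N -> mu.-integrable `[0, 1] (EFin \o F) ->
  (forall (j : nat) (y : R), (j < n)%N -> j%:R / n%:R <= y <= j.+1%:R / n%:R ->
     `|F y - F (j%:R / n%:R)| <= e) ->
  `|n%:R^-1 * \sum_(j < n) F (j%:R / n%:R) - \int[mu]_(y in `[0, 1]) F y| <= e.
Proof.
move=> mu n0 iF Fe.
have nR : 0 < n%:R :> R by rewrite ltr0n.
have nR0 : n%:R != 0 :> R by rewrite gt_eqF.
(* The error is accumulated cell by cell. *)
suff H k : (k <= n)%N -> `|n%:R^-1 * \sum_(j < k) F (j%:R / n%:R)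
    - \int[mu]_(y in `[0, k%:R / n%:R]) F y| <= e * (k%:R / n%:R).
  by have := H n (leqnn n); rewrite mulfV// mulr1.
elim: k => [_|k IHk kn].
  by rewrite big_ord0 mulr0 mul0r set_itv1 Rintegral_set1 mulr0 subrr normr0.
have kk : k%:R / n%:R < k.+1%:R / n%:R :> R by rewrite ltr_pM2r ?invr_gt0// ltr_nat.
have k0 : 0 <= k%:R / n%:R :> R by rewrite divr_ge0.
have k1 : k.+1%:R / n%:R <= 1 :> R by rewrite ler_pdivrMr// mul1r ler_nat.
have iS (i : interval R) : [set` i] `<=` `[0, 1] -> mu.-integrable [set` i] (EFin \o F).
  by move=> iS; apply: integrableS iF.
have iFk : mu.-integrable `[0, k.+1%:R / n%:R] (EFin \o F).
  by apply: iS; apply: subset_itvl; rewrite bnd_simp.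
have split_ := @Rintegral_itvB R F (BLeft 0) (BRight (k.+1%:R / n%:R)) (k%:R / n%:R) iFk.
have {split_}E : \int[mu]_(y in `[0, k.+1%:R / n%:R]) F y =
    \int[mu]_(y in `[0, k%:R / n%:R]) F y +
    \int[mu]_(y in `](k%:R / n%:R), (k.+1%:R / n%:R)]) F y.
  by rewrite -split_ ?bnd_simp// ?ltW//; ring.
have muk : mu `](k%:R / n%:R), (k.+1%:R / n%:R)]%classic = (n%:R^-1)%:E.
  rewrite /mu lebesgue_measure_itv/= lte_fin kk -EFinB; congr EFin.
  by rewrite -natr1; field.
have := @Rintegral_near_cst R `](k%:R / n%:R), (k.+1%:R / n%:R)]%classic F
  (F (k%:R / n%:R)) e (measurable_itv _).
rewrite -/mu muk/= ltry => /(_ isT) h.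
have {}h : `|\int[mu]_(y in `](k%:R / n%:R), (k.+1%:R / n%:R)]) F y -
    F (k%:R / n%:R) * n%:R^-1| <= e * n%:R^-1.
  apply: h.
    apply: iS => x /=; rewrite !in_itv/= => /andP[h1 h2].
    by rewrite (le_trans k0 (ltW h1)) (le_trans h2).
  move=> y; rewrite /= in_itv/= => /andP[h1 h2].
  by apply: Fe => //; rewrite ltW.
rewrite big_ord_recr/= E.
set J := \int[mu]_(y in `](k%:R / n%:R), (k.+1%:R / n%:R)]) F y in h *.
have -> : e * (k.+1%:R / n%:R) = e * (k%:R / n%:R) + e * n%:R^-1.
  by rewrite -natr1; field.
have := IHk (ltnW kn).
set I := \int[mu]_(y in _) _; set S := \sum_(j < k) _ => hI.
have -> : n%:R^-1 * (S + F (k%:R / n%:R)) - (I + J) =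
  (n%:R^-1 * S - I) - (J - F (k%:R / n%:R) * n%:R^-1) by ring.
by apply: le_trans (ler_normB _ _) _; exact: lerD.
Qed.

(** Compactness of the segment, in the near-covering form: the modulus [d] is
    the parameter that goes to 0 from the right. *)
Lemma segment_unif_continuous (R : realType) (a b : R) (f : R -> R) :
  {within `[a, b], continuous f} -> forall e, 0 < e ->
  exists2 d, 0 < d & forall x y, a <= x <= b -> a <= y <= b -> `|x - y| <= d ->
    `|f x - f y| < e.
Proof.
move=> fc e e0.
have /compact_near_coveringP := @segment_compact R a b.
pose P (d x : R) := a <= x <= b -> forall y, a <= y <= b -> `|x - y| <= d -> `|f x - f y| < e.
move=> /(_ R 0^'+ P _) H.
have {H} : \forall d \near 0^'+, `[a, b] `<=` P d.
  apply: H => x; rewrite /= in_itv/= => xab.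
  have /subspace_continuousP/(_ x) := fc.
  rewrite /= in_itv /= => /(_ xab) /cvgr_dist_lt/(_ (e / 2)).
  rewrite divr_gt0// => /(_ isT) /nbhs_ballP[r/= r0 hr].
  have r20 : 0 < r / 2 by rewrite divr_gt0.
  exists (ball x (r / 2), [set d | d < r / 2]); first split => /=.
  - exact: nbhsx_ballx.
  - exact: nbhs_right_lt.
  move=> [z d] [/= xz dr] zab y yab zyd.
  have h1 : `|f x - f z| < e / 2.
    apply: (hr z); last by rewrite /= in_itv.
    by apply: le_ball xz; rewrite ler_pdivrMr// ler_peMr ?ler1n// ltW.
  have h2 : `|f x - f y| < e / 2.
    apply: (hr y); last by rewrite /= in_itv.
    rewrite /ball/= in xz *.
    have -> : x - y = (x - z) + (z - y) by ring.
    by rewrite (le_lt_trans (ler_normD _ _))//; lra.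
  have -> : f z - f y = (f x - f y) - (f x - f z) by ring.
  by rewrite (le_lt_trans (ler_normB _ _))//; lra.
move=> H.
near (0 : R)^'+ => d.
exists d => // x y xab; have : `[a, b] `<=` P d by near: d.
by move=> /(_ x); rewrite /= in_itv/= => /(_ xab); apply.
Unshelve. all: by end_near. Qed.

(** A null set contains no nondegenerate interval, so every point of [0, 1] has
    arbitrarily close points at which the bound holds. *)
Lemma ae_le_continuous_le (R : realType) (f : R -> R) (e : R) :
  {within `[0, 1], continuous f} ->
  {ae @lebesgue_measure R, forall x, 0 <= x <= 1 -> `|f x| <= e} ->
  forall x, 0 <= x <= 1 -> `|f x| <= e.
Proof.
move=> fc [N [mN N0 sN]] x x01; apply/ler_addgt0Pr => h h0.
have [d d0 fd] := segment_unif_continuous fc h0.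
have [a [b [ab ab01 abx]]] : exists a b : R, [/\ a < b,
    (forall y, a <= y <= b -> 0 <= y <= 1) & forall y, a <= y <= b -> `|x - y| <= d].
  pose d' := Num.min d (1 / 2).
  have d'0 : 0 < d' by rewrite lt_min d0/=; lra.
  have d'd : d' <= d by rewrite ge_min lexx.
  have d'2 : d' <= 1 / 2 by rewrite ge_min lexx orbT.
  move: x01 => /andP[x0 x1].
  have [hx|hx] := leP x (1 / 2).
    exists x, (x + d'); split; first by lra.
      by move=> y /andP[? ?]; apply/andP; split; lra.
    by move=> y /andP[? ?]; rewrite ler_norml; apply/andP; split; lra.
  exists (x - d'), x; split; first by lra.
    by move=> y /andP[? ?]; apply/andP; split; lra.
  by move=> y /andP[? ?]; rewrite ler_norml; apply/andP; split; lra.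
have [y [yab yN]] : exists y, a <= y <= b /\ ~ N y.
  apply: contrapT => H.
  have sub : `[a, b] `<=` N.
    move=> y; rewrite /= in_itv/= => yab; apply: contrapT => yN.
    by apply: H; exists y.
  have mab : measurable (`[a, b]%classic : set (measurableTypeR R)).
    exact: measurable_itv.
  have mE : @lebesgue_measure R `[a, b] = (b - a)%:E.
    by rewrite lebesgue_measure_itv/= lte_fin ab -EFinB.
  have /eqP := etrans (esym mE) (subset_measure0 mab mN sub N0).
  by rewrite eqe subr_eq0 gt_eqF.
have fy : `|f y| <= e.
  apply: contrapT => fye; apply: yN; apply: sN => /= H.
  by apply: fye; apply: H; exact: ab01.
have fxy := fd x y x01 (ab01 _ yab) (abx _ yab).
have -> : f x = f y + (f x - f y) by ring.
by rewrite (le_trans (ler_normD _ _))// lerD// ltW.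
Qed.

(** * Regularity of the continuum model *)

Definition mean_field (R : realType) (theta : R -> R -> R) (t x : R) : R :=
  \int[lebesgue_measure]_(y in `[0, 1]) sin (theta t y - theta t x).

Section continuum.
Variables (R : realType) (theta : R -> R -> R).
Hypothesis htheta : continuum_kuramoto theta.

Lemma integrable_sin_phase (t z : R) : 0 <= t ->
  (@lebesgue_measure R).-integrable `[0, 1] (EFin \o (fun y => sin (theta t y - z))).
Proof.
move=> t0; have mt := htheta.1 t t0.
have mu1 : (@lebesgue_measure R `[0%R, 1%R] < +oo)%E by rewrite lebesgue_unit_itv ltry.
apply: measurable_bounded_integrable.
- exact: measurable_itv.
- exact: mu1.
- have ms : measurable_fun [set: R] (fun p : R => sin (p - z)).
    apply: measurable_realfun.continuous_measurable_fun.
    move=> x; apply: (@continuous_comp _ _ _ (fun p => p - z) (@sin R)).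
      by apply: (@continuousB _ _ _ id (cst z)); [exact: id|exact: cst_continuous].
    exact: continuous_sin.
  exact: (measurableT_comp ms mt).
- exists 1; split => // M M1 y _; apply: ltW; apply: le_lt_trans M1.
  by rewrite /= ler_norml sin_geN1 sin_le1.
Qed.

Lemma mean_field_le1 (t x : R) : 0 <= t -> `|mean_field theta t x| <= 1.
Proof.
move=> t0; apply: Rintegral_unit_bound; first exact: integrable_sin_phase.
by move=> y _; rewrite ler_norml sin_geN1 sin_le1.
Qed.

(** The dependence of the velocity on the position is only through the phase, so
    two positions with close phases move apart at most exponentially. *)
Lemma mean_field_lipschitz (t x x' : R) : 0 <= t ->
  `|mean_field theta t x - mean_field theta t x'| <= `|theta t x - theta t x'|.
Proof.
move=> t0; rewrite /mean_field.
have i1 := @integrable_sin_phase t (theta t x) t0.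
have i2 := @integrable_sin_phase t (theta t x') t0.
have mI : measurable (`[0, 1]%classic : set (measurableTypeR R)) by exact: measurable_itv.
rewrite -(RintegralB mI i1 i2).
apply: Rintegral_unit_bound.
  have := integrableB mI i1 i2.
  by apply: eq_integrable.
move=> y _; apply: le_trans (sin_lipschitz _ _) _.
rewrite (_ : _ - _ - _ = - (theta t x - theta t x')) ?normrN//.
by ring.
Qed.

Lemma theta_time_continuous (T x : R) : 0 <= x <= 1 ->
  {within `[0, T], continuous (fun t => theta t x)}.
Proof.
move=> x01; have [c _] := htheta.2 x x01.
by apply: continuous_subspaceW c; apply: subset_itvl; rewrite bnd_simp.
Qed.

Lemma theta_time_lipschitz (x s t : R) : 0 <= x <= 1 -> 0 <= s -> 0 <= t ->
  `|theta t x - theta s x| <= `|t - s|.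
Proof.
move=> x01.
wlog st : s t / s <= t => [hw s0 t0|s0 t0].
  have [st|/ltW ts] := leP s t; first exact: hw.
  by rewrite distrC [leRHS]distrC; exact: hw.
have [c cst E] : exists2 c, c \in `[s, t] &
    theta t x - theta s x = mean_field theta c x * (t - s).
  apply: (@MVT_segment _ (fun r => theta r x) (fun r => mean_field theta r x)) => //.
    move=> r; rewrite in_itv/= => /andP[sr _].
    by apply: (htheta.2 x x01).2; exact: le_lt_trans sr.
  apply: continuous_subspaceW (htheta.2 x x01).1 => r /=.
  by rewrite !in_itv/= andbT => /andP[/(le_trans s0)].
rewrite E normrM ler_piMl// mean_field_le1//.
by move: cst; rewrite in_itv/= => /andP[/(le_trans s0)].
Qed.

(** Two positions solve the same scalar equation, driven by the whole
    population; so the initial modulus of continuity is propagated. This gives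
    the spatial regularity that the definition of a solution does not include. *)
Lemma theta_space_modulus (t x x' K : R) : 0 <= t -> 0 <= x <= 1 -> 0 <= x' <= 1 ->
  `|theta 0 x - theta 0 x'| < K ->
  `|theta t x - theta t x'| < K * expR (2 * t).
Proof.
move=> t0 x01 x'01 K0'; have K0 : 0 < K by apply: le_lt_trans K0'.
have -> : 2 = 1 + 1 :> R by ring.
apply: (@sup_gronwall R unit (fun _ s => theta s x - theta s x')
  (fun _ s => mean_field theta s x - mean_field theta s x') t 1 0 K _ _ _ _ _ _ _ t tt) => //.
- exact: ltW.
- by move=> _; apply: within_continuousB; exact: theta_time_continuous.
- move=> _ s /andP[s0 _].
  have := (htheta.2 x x01).2 s s0; have := (htheta.2 x' x'01).2 s s0.
  by move=> ? ?; exact: is_deriveB.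
- move=> _ s B /andP[s0 _] /(_ tt) H; rewrite mul1r addr0; apply: le_trans H.
  by apply: mean_field_lipschitz; exact: ltW.
- by rewrite t0 lexx.
Qed.

Hypothesis htheta0 : {within `[0, 1], continuous (theta 0)}.

Lemma theta_space_unif (T e : R) : 0 < e ->
  exists2 d, 0 < d & forall t x x', 0 <= t <= T -> 0 <= x <= 1 -> 0 <= x' <= 1 ->
    `|x - x'| <= d -> `|theta t x - theta t x'| < e.
Proof.
move=> e0; pose K := e / expR (2 * T).
have K0 : 0 < K by rewrite divr_gt0 ?expR_gt0.
have [d d0 hd] := segment_unif_continuous htheta0 K0.
exists d => // t x x' /andP[t0 tT] x01 x'01 xx'.
apply: lt_le_trans (theta_space_modulus t0 x01 x'01 (hd _ _ x01 x'01 xx')) _.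
by rewrite /K -mulrA ler_piMr ?(ltW e0)// mulrC ler_pdivrMr ?expR_gt0// mul1r
  ler_expR ler_wpM2l.
Qed.

Lemma theta_space_continuous (t : R) : 0 <= t ->
  {within `[0, 1], continuous (theta t)}.
Proof.
move=> t0; apply/subspace_continuousP => x; rewrite /= in_itv/= => x01.
apply/cvgrPdist_lt => e e0.
have [d d0 hd] := theta_space_unif t e0.
apply/nbhs_ballP; exists d => //= y xy; rewrite in_itv/= => y01.
by apply: hd => //; [rewrite t0 lexx|exact: ltW].
Qed.

Lemma mean_field_riemann (n : nat) (e t : R) (x : R) : (0 < n)%N -> 0 <= t ->
  (forall y y', 0 <= y <= 1 -> 0 <= y' <= 1 -> `|y - y'| <= n%:R^-1 ->
    `|theta t y - theta t y'| <= e) ->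
  `|n%:R^-1 * \sum_(j < n) sin (theta t (j%:R / n%:R) - theta t x)
     - mean_field theta t x| <= e.
Proof.
move=> n0 t0 he.
apply: (@riemann_sum_error R n (fun y => sin (theta t y - theta t x)) e n0).
  exact: integrable_sin_phase.
have nR : 0 < n%:R :> R by rewrite ltr0n.
move=> j y jn /andP[jy yj].
have j0 : 0 <= j%:R / n%:R :> R by rewrite divr_ge0.
have j1 : j.+1%:R / n%:R <= 1 :> R by rewrite ler_pdivrMr// mul1r ler_nat.
apply: le_trans (sin_lipschitz _ _) _.
rewrite (_ : _ - _ - _ = theta t y - theta t (j%:R / n%:R)); last by ring.
apply: he.
- by rewrite (le_trans j0 jy) (le_trans yj).
- by rewrite j0 (le_trans jy)// (le_trans yj).
rewrite ger0_norm ?subr_ge0// lerBlDl (le_trans yj)//.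
by rewrite -natr1 mulrDl mul1r.
Qed.

Lemma sync_time (c : R) :
  Linfty01_norm (fun x => theta t x - c) @[t --> +oo] --> 0%E ->
  forall e : R, 0 < e ->
  exists2 T, 0 < T & forall x, 0 <= x <= 1 -> `|theta T x - c| <= e.
Proof.
pose N t := Linfty01_norm (fun x => theta t x - c).
move=> hs e e0.
have H : \forall t \near +oo, (N t < e%:E)%E.
  apply: (hs [set u | (u < e%:E)%E]).
  by apply: (@open_ereal_lt' _ 0%E); rewrite lte_fin.
have : \forall t \near +oo, 0 < t /\ (N t < e%:E)%E.
  by near=> t; split; [near: t; exact: nbhs_pinfty_gt|near: t].
move=> /pinfty_ex_gt0[T T0 [_ hT]]; exists T => //.
apply: ae_le_continuous_le.
  apply: (@within_continuous_comp _ _ (theta T) (fun p => p - c)).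
    exact/theta_space_continuous/ltW.
  by move=> x; apply: (@continuousB _ _ _ id (cst c)); [exact: id|exact: cst_continuous].
move: hT; rewrite /N /Linfty01_norm unlock.
have muT : (0 < @lebesgue_measure R setT)%E.
  by rewrite -set_itvNyy lebesgue_measure_itv/= adde_gt0 ?ltry.
case: ifPn => [_ /ltW/ess_sup_inf.ess_supP h|/negP]; last by case.
apply: filterS h => x /= h x01; move: h.
by rewrite patchE mem_set//= lee_fin.
Unshelve. all: by end_near. Qed.
End continuum.

(** * Concentration and connectivity of the random graph *)

Lemma measure_union_bound (d : measure_display) (T : measurableType d)
    (R : realType) (P : {measure set T -> \bar R}) (I : finType) (Q : pred I)
    (X : set T) (E : I -> set T) :
  measurable X -> (forall i, measurable (E i)) ->
  (forall w, X w -> exists2 i, Q i & E i w) ->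
  (P X <= \sum_(i | Q i) P (E i))%E.
Proof.
move=> mX mE XE.
have mU (r : seq I) : measurable (\big[setU/set0]_(i <- r | Q i) E i).
  by apply: bigsetU_measurable => i _.
apply: (@le_trans _ _ (P (\big[setU/set0]_(i <- index_enum I | Q i) E i))).
  apply: le_measure; rewrite ?inE// => w /XE[i Qi Ei].
  rewrite -bigcup_seq_cond; exists i => //=.
  by rewrite mem_index_enum.
elim: (index_enum I) => [|i r IH]; first by rewrite !big_nil measure0.
rewrite !big_cons; case: ifP => // Qi.
by apply: (le_trans (measureU2 _ (mE i) (mU r))); rewrite leeD2l.
Qed.

(** From exp (- y) >= 1 - y: the product of 1 - y with the right-hand side is
    1 + y ^ 2 (1 - 2 y). *)
Lemma expR_le_quadratic (R : realType) (y : R) : y <= 1 / 2 ->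
  expR y <= 1 + y + 2 * y ^+ 2.
Proof.
move=> y2; have y1 : 0 < 1 - y by lra.
have h : expR y * (1 - y) <= 1.
  have E : expR y * expR (- y) = 1 by rewrite -expRD subrr expR0.
  rewrite -[leRHS]E ler_wpM2l ?expR_ge0//.
  by have := expR_ge1Dx (- y).
have q : 1 <= (1 + y + 2 * y ^+ 2) * (1 - y).
  have -> : (1 + y + 2 * y ^+ 2) * (1 - y) = 1 + y ^+ 2 * (1 - 2 * y) by ring.
  by rewrite lerDl mulr_ge0 ?sqr_ge0//; lra.
by rewrite -(ler_pM2r y1) (le_trans h).
Qed.

(** The first-order terms cancel because the variable is centered; the second
    order term is at most the variance, hence at most a multiple of p. *)
Lemma bernoulli_mgf (R : realType) (p x : R) : 0 <= p <= 1 -> `|x| <= 1 / 2 ->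
  p * expR (x * (1 - p)) + (1 - p) * expR (x * (0 - p)) <= expR (2 * x ^+ 2 * p).
Proof.
move=> /andP[p0 p1] xh; have q0 : 0 <= 1 - p by lra.
have small (z : R) : `|z| <= 1 -> x * z <= 1 / 2.
  move=> z1; apply: le_trans (ler_norm _) _; rewrite normrM.
  by apply: le_trans xh; rewrite ler_piMr.
have h1 := expR_le_quadratic (small (1 - p) _).
have h2 := expR_le_quadratic (small (0 - p) _).
apply: le_trans (expR_ge1Dx _).
have {}h1 : p * expR (x * (1 - p)) <= p * (1 + x * (1 - p) + 2 * (x * (1 - p)) ^+ 2).
  by rewrite ler_wpM2l// h1// ger0_norm//; lra.
have {}h2 : (1 - p) * expR (x * (0 - p)) <= (1 - p) * (1 + x * (0 - p) + 2 * (x * (0 - p)) ^+ 2).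
  by rewrite ler_wpM2l// h2// sub0r normrN ger0_norm.
apply: le_trans (lerD h1 h2) _.
have -> : p * (1 + x * (1 - p) + 2 * (x * (1 - p)) ^+ 2) +
  (1 - p) * (1 + x * (0 - p) + 2 * (x * (0 - p)) ^+ 2) =
  1 + 2 * x ^+ 2 * p * (1 - p) by ring.
have : 0 <= x ^+ 2 * p * p by rewrite mulr_ge0// mulr_ge0// sqr_ge0.
lra.
Qed.

(** Independence is known for the entries on or above the diagonal; an edge is
    represented by its ordered pair of ends. *)
Definition ordered_pair (n : nat) (e : 'I_n * 'I_n) : 'I_n * 'I_n :=
  if (e.1 <= e.2)%N then e else (e.2, e.1).

Lemma ordered_pair_eq (n : nat) (e f : 'I_n * 'I_n) :
  ordered_pair e = ordered_pair f -> e = f \/ e = (f.2, f.1).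
Proof.
case: e f => [e1 e2] [f1 f2]; rewrite /ordered_pair/=.
by case: ifP => _; case: ifP => _ [-> ->]; [left|right|right|left].
Qed.

Section random_graph.
Variables (d : measure_display) (Omega : measurableType d) (R : realType).
Variables (P : probability Omega R) (n : nat) (p : R).
Variable A : 'I_n -> 'I_n -> {mfun Omega >-> bool}.
Hypotheses (hA : erdos_renyi P p A) (p01 : 0 <= p <= 1).

(** As the values of this function form a finite type, every event expressed
    through it is a finite union of elementary events. *)
Definition graph_at (w : Omega) : {ffun 'I_n * 'I_n -> bool} :=
  [ffun e => A e.1 e.2 w].

Lemma measurable_edge (i j : 'I_n) (b : bool) : measurable (A i j @^-1` [set b]).
Proof. by rewrite -[X in measurable X]setTI; exact: measurable_funP. Qed.

Lemma measurable_graph_event (Q : {ffun 'I_n * 'I_n -> bool} -> Prop) :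
  measurable [set w | Q (graph_at w)].
Proof.
rewrite (_ : [set w | _] = \bigcup_(b in [set b | Q b])
    \bigcap_(e in setT) A e.1 e.2 @^-1` [set b e]).
  apply: fin_bigcup_measurable => // b _.
  by apply: fin_bigcap_measurable => // e _; exact: measurable_edge.
apply/seteqP; split => [w Qw|w [b Qb hb]] /=.
  by exists (graph_at w) => // e _ /=; rewrite ffunE.
rewrite (_ : graph_at w = b)//; apply/ffunP => e; rewrite ffunE.
exact: (hb e I).
Qed.

Lemma edge_probability (i j : 'I_n) (b : bool) :
  P (A i j @^-1` [set b]) = (bernoulli_pmf p b)%:E.
Proof.
have [_ /(_ i j [set b]) + _] := hA; rewrite /distribution/= /pushforward => ->.
by rewrite /bernoulli_prob p01 fsbig_set1.
Qed.

Lemma ordered_pairE (e : 'I_n * 'I_n) (w : Omega) :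
  A (ordered_pair e).1 (ordered_pair e).2 w = A e.1 e.2 w.
Proof. by have [sym _ _] := hA; rewrite /ordered_pair; case: ifP. Qed.

(** The product rule for an arbitrary indexed family of edges, provided that it
    does not list any edge twice, be it with its ends exchanged. *)
Lemma joint_edge_probability (K : finType) (K0 : {set K}) (s : K -> 'I_n * 'I_n)
    (b : K -> bool) :
  {in K0 &, injective (fun k => ordered_pair (s k))} ->
  P [set w | forall k, k \in K0 -> A (s k).1 (s k).2 w = b k] =
  (\prod_(k in K0) bernoulli_pmf p (b k))%:E.
Proof.
move=> inj; have [_ _ ind] := hA.
pose J := [set ordered_pair (s k) | k in K0]%SET.
(* The target set of an edge is read off any index that lists it; by
   injectivity there is only one. *)
pose B e : set bool := [set b' | exists k, [/\ k \in K0, ordered_pair (s k) = e & b' = b k]].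
have BE k : k \in K0 -> B (ordered_pair (s k)) = [set b k].
  move=> kK; apply/seteqP; split => [b' [k' [k'K E ->]]|b' ->] /=.
    by rewrite (inj _ _ k'K kK E).
  by exists k.
have mB e : measurable (B e) by [].
have JD : J \subset [set ij : 'I_n * 'I_n | (ij.1 <= ij.2)%N]%SET.
  apply/fintype.subsetP => _ /imsetP[k _ ->]; rewrite inE /ordered_pair.
  by case: ifPn => //=; rewrite -ltnNge => /ltnW.
have := ind J B JD mB.
rewrite big_imset//= -prodEFin.
rewrite (_ : \bigcap_(i in _) _ = [set w | forall k, k \in K0 -> A (s k).1 (s k).2 w = b k]).
  move=> ->; apply: eq_bigr => k kK.
  by rewrite BE// edge_probability.
apply/seteqP; split => [w hw k kK|w hw _ /imsetP[k kK ->]] /=.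
  have := hw (ordered_pair (s k)) (imset_f _ kK).
  by rewrite /= BE//= ordered_pairE.
by rewrite BE//= ordered_pairE hw.
Qed.

(** Chernoff's bound, computed on the finitely many values of the row: the
    exponential moment of a row is a product over its entries, and each factor
    is bounded by [bernoulli_mgf]. The exponent has [n%:R * p], not [n%:R],
    because the variance of an entry is at most p. *)
Lemma row_tail (i : 'I_n) (g : 'I_n -> R) (e : R) :
  (forall j, `|g j| <= 1) -> 0 < e <= 1 ->
  (P [set w | (e * (n%:R * p) < \sum_(j < n) ((A i j w)%:R - p) * g j)%R]
   <= (expR (- (e ^+ 2 / 8 * (n%:R * p))))%:E)%E.
Proof.
move=> g1 /andP[e0 e1].
pose row (b : {ffun 'I_n -> bool}) := [set w | forall j, j \in [set: 'I_n]%SET -> A i j w = b j].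
pose S (b : {ffun 'I_n -> bool}) : R := \sum_(j < n) ((b j)%:R - p) * g j.
(* The exponent 2 n p l ^ 2 - l t is minimal at l = e / 4. *)
pose t := e * (n%:R * p); pose l := e / 4.
have l0 : 0 <= l by rewrite divr_ge0 ?ltW.
have mrow b : measurable (row b).
  have := measurable_graph_event (fun a => forall j, j \in [set: 'I_n]%SET -> a (i, j) = b j).
  rewrite (_ : [set w | _] = row b)//.
  by apply/seteqP; split => w /= h j jT; have := h j jT; rewrite ffunE.
have inj : {in [set: 'I_n]%SET &, injective (fun j => ordered_pair (i, j))}.
  by move=> j j' _ _ /ordered_pair_eq[[]//|[-> ->]].
have prow b : P (row b) = (\prod_(j < n) bernoulli_pmf p (b j))%:E.
  rewrite (joint_edge_probability b inj); congr EFin.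
  by apply: eq_bigl => j; rewrite inE.
have mX : measurable [set w | t < \sum_(j < n) ((A i j w)%:R - p) * g j].
  have E w : \sum_(j < n) ((A i j w)%:R - p) * g j =
             \sum_(j < n) ((graph_at w (i, j))%:R - p) * g j.
    by apply: eq_bigr => j _; rewrite ffunE.
  rewrite (_ : [set w | _] = [set w | t < \sum_(j < n) ((graph_at w (i, j))%:R - p) * g j]).
    exact: (measurable_graph_event (fun a => t < \sum_(j < n) ((a (i, j))%:R - p) * g j)).
  by apply/seteqP; split => w /=; rewrite E.
apply: (@le_trans _ _ (\sum_(b | (t < S b)%R) P (row b))%E).
  apply: (@measure_union_bound _ _ _ P _ (fun b => t < S b) _ row mX mrow).
  move=> w /= tw; exists [ffun j => A i j w].
    by rewrite /S; under eq_bigr do rewrite ffunE.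
  by move=> j _; rewrite ffunE.
under eq_bigr do rewrite prow.
rewrite sumEFin lee_fin.
apply: (@le_trans _ _ (\sum_(b : {ffun 'I_n -> bool})
   expR (- (l * t)) * \prod_(j < n) (bernoulli_pmf p (b j) * expR (l * g j * ((b j)%:R - p))))).
  (* Markov's inequality: the indicator of t < S b is at most
     expR (l * (S b - t)). *)
  rewrite [leLHS]big_mkcond/=; apply: ler_sum => b _.
  have pb0 : 0 <= \prod_(j < n) bernoulli_pmf p (b j).
    by apply: prodr_ge0 => j _; exact: bernoulli_pmf_ge0.
  have -> : expR (- (l * t)) * \prod_(j < n) (bernoulli_pmf p (b j) * expR (l * g j * ((b j)%:R - p)))
     = expR (l * (S b - t)) * \prod_(j < n) bernoulli_pmf p (b j).
    rewrite big_split/= -expR_sum mulrCA mulrC -expRD; congr (expR _ * _).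
    rewrite mulrBr addrC; congr (_ - _).
    by rewrite /S mulr_sumr; apply: eq_bigr => j _; ring.
  case: ifP => [tS|_]; last by rewrite mulr_ge0// expR_ge0.
  rewrite ler_peMl// -expR0 ler_expR mulr_ge0// subr_ge0; exact: ltW.
rewrite -mulr_sumr.
rewrite -(bigA_distr_bigA (fun j b => bernoulli_pmf p b * expR (l * g j * (b%:R - p)))).
apply: (@le_trans _ _ (expR (- (l * t)) * \prod_(j < n) expR (2 * l ^+ 2 * p))).
  rewrite ler_wpM2l ?expR_ge0//; apply: ler_prod => j _; apply/andP; split.
    by apply: sumr_ge0 => b _; rewrite mulr_ge0 ?expR_ge0// bernoulli_pmf_ge0.
  rewrite big_bool/= /bernoulli_pmf.
  have lg : `|l * g j| <= l by rewrite normrM ger0_norm// ler_piMr.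
  apply: le_trans (bernoulli_mgf p01 _) _.
    by apply: le_trans lg _; rewrite /l; lra.
  have : (l * g j) ^+ 2 <= l ^+ 2.
    by rewrite -(real_normK (num_real (l * g j))) lerXn2r// nnegrE.
  move=> h; rewrite ler_expR ler_wpM2r//; first by case/andP: p01.
  by rewrite ler_wpM2l.
rewrite -expR_sum -expRD ler_expR sumr_const card_ord -[_ *+ n]mulr_natl.
rewrite le_eqVlt; apply/orP; left; apply/eqP; by rewrite /l /t; field.
Qed.

(** The edges across a cut are distinct even as unordered pairs, so they are
    absent independently of each other. *)
Lemma cut_probability (S : {set 'I_n}) :
  P [set w | forall i j, i \in S -> j \notin S -> ~~ A i j w] =
  ((1 - p) ^+ (#|S| * (n - #|S|)))%:E.
Proof.
pose K0 := finset.setX S (~: S).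
have inj : {in K0 &, injective (fun e => ordered_pair e)}.
  move=> e f; rewrite !inE => /andP[e1 e2] /andP[f1 f2] /ordered_pair_eq[//|E].
  by move: e1; rewrite E/= (negPf f2).
have := joint_edge_probability (fun=> false) inj.
rewrite /= prodr_const cardsX [#|~: S|]cardsCs finset.setCK card_ord => <-; congr (P _).
apply/seteqP; split => w /= h.
  by move=> [i j]; rewrite !inE /= => /andP[iS jS]; apply/negbTE/h.
by move=> i j iS jS; rewrite (h (i, j))// !inE /= iS.
Qed.

Definition edge_rel (w : Omega) : rel 'I_n := fun i j => A i j w.

(** The component of [i], or its complement when the component has more than
    half of the vertices. *)
Lemma disconnected_cut (w : Omega) (i j : 'I_n) :
  ~~ connect (edge_rel w) i j ->
  exists2 S : {set 'I_n}, (0 < #|S|)%N && (#|S|.*2 <= n)%N &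
    forall k l, k \in S -> l \notin S -> ~~ A k l w.
Proof.
move=> ij; have [sym _ _] := hA.
pose C := [set k | connect (edge_rel w) i k]%SET.
have iC : i \in C by rewrite inE.
have jC : j \in ~: C by rewrite !inE.
have out k l : k \in C -> l \notin C -> ~~ A k l w.
  rewrite !inE => ik; apply: contra => kl.
  by apply: connect_trans ik (connect1 _).
have cardC : (#|C| + #|~: C| = n)%N by rewrite cardsC card_ord.
have [le|lt] := leqP #|C|.*2 n.
  by exists C => //; rewrite le andbT; apply/card_gt0P; exists i.
exists (~: C).
  apply/andP; split; first by apply/card_gt0P; exists j.
  by rewrite -(leq_add2l #|C|.*2) -doubleD cardC -addnn leq_add2r ltnW.
move=> k l kC; rewrite inE negbK => lC; rewrite sym; apply: out => //.
by rewrite inE in kC.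
Qed.

(** A cut with at most half of the vertices on one side has at least [n / 2]
    edges for each of them, so it is empty with probability at most q ^ #|S|,
    q = exp (- n p / 2); summed over all nonempty S this is (1 + q) ^ n - 1. *)
Lemma disconnected_probability :
  (P [set w | ~ (forall i j, connect (edge_rel w) i j)] <=
   ((1 + expR (- (n%:R * p / 2))) ^+ n - 1)%:E)%E.
Proof.
set q := expR _.
pose cut (S : {set 'I_n}) := [set w | forall i j, i \in S -> j \notin S -> ~~ A i j w].
have mcut S : measurable (cut S).
  have := measurable_graph_event (fun a => forall i j, i \in S -> j \notin S -> ~~ a (i, j)).
  rewrite (_ : [set w | _] = cut S)//.
  by apply/seteqP; split => w /= h i j iS jS; have := h i j iS jS; rewrite ffunE.
have mX : measurable [set w | ~ (forall i j, connect (edge_rel w) i j)].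
  have := measurable_graph_event
    (fun a => ~ (forall i j, connect (fun k l => a (k, l)) i j)).
  rewrite (_ : [set w | _] = [set w | ~ (forall i j, connect (edge_rel w) i j)])//.
  have E w : (fun k l => graph_at w (k, l)) =2 edge_rel w by move=> k l; rewrite ffunE.
  by apply/seteqP; split => w /= h H; apply: h => i j; have := H i j;
    rewrite (eq_connect (E w)).
pose Q (S : {set 'I_n}) := (0 < #|S|)%N && (#|S|.*2 <= n)%N.
apply: (@le_trans _ _ (\sum_(S | Q S) P (cut S))%E).
  apply: (@measure_union_bound _ _ _ P _ Q _ cut mX mcut) => w /= h.
  have [i [j ij]] : exists i j, ~~ connect (edge_rel w) i j.
    apply: contrapT => H; apply: h => i j; apply: contrapT => ij.
    by apply: H; exists i, j; apply/negP.
  by have [S QS hS] := disconnected_cut ij; exists S.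
under eq_bigr do rewrite cut_probability.
rewrite sumEFin lee_fin.
have -> : (1 + q) ^+ n - 1 = \sum_(S : {set 'I_n} | S != finset.set0) q ^+ #|S|.
  have -> : (1 + q) ^+ n = \sum_(S : {set 'I_n}) q ^+ #|S|.
    have -> : (1 + q) ^+ n = \prod_(i < n) (q + 1).
      by rewrite prodr_const card_ord addrC.
    rewrite bigA_distr /=; apply: eq_bigr => S _.
    by rewrite -big_mkcond/= prodr_const.
  by rewrite (bigD1 finset.set0)//= cards0 expr0 addrAC subrr add0r.
rewrite [leLHS]big_mkcond [leRHS]big_mkcond/=; apply: ler_sum => S _.
have q0 : 0 <= q by exact: expR_ge0.
rewrite /Q; case: ifP => [/andP[S0 S2]|_]; last by case: ifP => // _; exact: exprn_ge0.
rewrite -card_gt0 S0.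
have /andP[p0 p1] := p01.
have h1p : 1 - p <= expR (- p) by exact: expR_ge1Dx.
apply: (@le_trans _ _ (expR (- p) ^+ (#|S| * (n - #|S|)))).
  by rewrite lerXn2r// nnegrE ?expR_ge0// subr_ge0.
rewrite /q -!expRM_natl ler_expR.
have Sn : (#|S| <= n)%N by rewrite (leq_trans _ S2)// -addnn leq_addr.
rewrite natrM natrB// !mulrN lerN2.
have S2R : 2 * #|S|%:R <= n%:R :> R by rewrite -natrM ler_nat mul2n.
have : 0 <= #|S|%:R * p * (n%:R - 2 * #|S|%:R) by rewrite !mulr_ge0// subr_ge0.
by lra.
Qed.

End random_graph.

(** * Typical graphs and their probability *)

Section typical_graph.
Variables (d : measure_display) (Omega : measurableType d) (R : realType).
Variables (P : probability Omega R) (n : nat) (p : R).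
Variable A : 'I_n -> 'I_n -> {mfun Omega >-> bool}.
Hypotheses (hA : erdos_renyi P p A) (p01 : 0 <= p <= 1).
Variables (J : finType) (row : J -> 'I_n) (g : J -> 'I_n -> R) (e : R).
Hypotheses (g1 : forall j k, `|g j k| <= 1) (e01 : 0 < e <= 1).

Let dev (w : Omega) (j : J) : R :=
  \sum_(k < n) ((A (row j) k w)%:R - p) * g j k.

(** Only upper deviations appear: a lower deviation is an upper deviation for the
    opposite weights, which the family [g] may contain. *)
Definition typical_graph : set Omega :=
  [set w | (forall i k, connect (edge_rel A w) i k) /\
           (forall j, dev w j <= e * (n%:R * p))].

Let graph_dev (a : {ffun 'I_n * 'I_n -> bool}) (j : J) : R :=
  \sum_(k < n) ((a (row j, k))%:R - p) * g j k.

Let graph_devE w j : graph_dev (graph_at A w) j = dev w j.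
Proof. by apply: eq_bigr => k _; rewrite ffunE. Qed.

Let graph_connectE w i k :
  connect (fun l m => graph_at A w (l, m)) i k = connect (edge_rel A w) i k.
Proof. by apply: eq_connect => l m; rewrite ffunE. Qed.

Lemma measurable_typical_graph : measurable typical_graph.
Proof.
have := measurable_graph_event A (fun a =>
  (forall i k, connect (fun l m => a (l, m)) i k) /\
  (forall j, graph_dev a j <= e * (n%:R * p))).
rewrite (_ : [set w | _] = typical_graph)//.
apply/seteqP; split => w [h1 h2]; split.
- by move=> i k; rewrite -graph_connectE.
- by move=> j; rewrite -graph_devE.
- by move=> i k; rewrite graph_connectE.
- by move=> j; rewrite graph_devE.
Qed.

Lemma typical_graph_probability (b : R) :
  #|J|%:R * expR (- (e ^+ 2 / 8 * (n%:R * p))) +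
    ((1 + expR (- (n%:R * p / 2))) ^+ n - 1) <= b ->
  ((1 - b)%:E <= P typical_graph)%E.
Proof.
move=> hb.
pose disc := [set w | ~ (forall i j, connect (edge_rel A w) i j)].
pose tail j := [set w | e * (n%:R * p) < dev w j].
have mtail j : measurable (tail j).
  have := measurable_graph_event A (fun a => e * (n%:R * p) < graph_dev a j).
  rewrite (_ : [set w | _] = tail j)//.
  by apply/seteqP; split => w; rewrite /tail/= graph_devE.
have mdisc : measurable disc.
  have := measurable_graph_event A (fun a => ~ (forall i k, connect (fun l m => a (l, m)) i k)).
  rewrite (_ : [set w | _] = disc)//.
  by apply/seteqP; split => w /= h H; apply: h => i k; have := H i k; rewrite graph_connectE.
pose tails := [set w | exists j, tail j w].
have mtails : measurable tails.
  rewrite (_ : tails = \bigcup_(j in setT) tail j).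
    by apply: fin_bigcup_measurable.
  by apply/seteqP; split => [w [j hj]|w [j _ hj]]; exists j.
have Ptails : (P tails <= (#|J|%:R * expR (- (e ^+ 2 / 8 * (n%:R * p))))%:E)%E.
  apply: (@le_trans _ _ (\sum_(j : J) P (tail j))%E).
    by apply: (@measure_union_bound _ _ _ P _ predT _ tail) => // w [j hj]; exists j.
  apply: (@le_trans _ _ (\sum_(j : J) (expR (- (e ^+ 2 / 8 * (n%:R * p))))%:E)%E).
    by apply: lee_sum => j _; exact: row_tail.
  by rewrite sumEFin lee_fin sumr_const -[_ *+ _]mulr_natl.
have Pbad : (P (disc `|` tails) <= b%:E)%E.
  apply: (le_trans (measureU2 _ mdisc mtails)).
  apply: (@le_trans _ _ (((1 + expR (- (n%:R * p / 2))) ^+ n - 1)%:E +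
     (#|J|%:R * expR (- (e ^+ 2 / 8 * (n%:R * p))))%:E)%E).
    by apply: leeD => //; exact: disconnected_probability.
  by rewrite -EFinD lee_fin addrC.
have -> : typical_graph = ~` (disc `|` tails).
  apply/seteqP; split => [w [h1 h2] [|[j]]|w h]; first by apply.
    by rewrite /tail/= ltNge h2.
  split=> [i k|j].
    by apply: contrapT => ik; apply: h; left => H; apply: ik.
  by rewrite leNgt; apply/negP => H; apply: h; right; exists j.
rewrite probability_setC; last exact: measurableU.
by rewrite EFinB; apply: leeB.
Qed.

End typical_graph.

(** Both exponentials are at most 1 / n ^ 2, which leaves 1 / n after the union
    over the rows, and likewise for the n-th power. *)
Lemma typical_graph_asymptotics (R : realType) (n : nat) (x e C : R) :
  (1 < n)%N -> 0 < e <= 1 -> 0 <= C -> 16 / e ^+ 2 * ln n%:R <= x ->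
  C * n%:R * expR (- (e ^+ 2 / 8 * x)) + ((1 + expR (- (x / 2))) ^+ n - 1) <=
  (C + 2) / n%:R.
Proof.
move=> n1 /andP[e0 e1] C0 hx.
have nR : 1 < n%:R :> R by rewrite ltr1n.
have n0 : 0 < n%:R :> R by apply: lt_trans nR.
have ln0 : 0 < ln n%:R :> R by exact: ln_gt0.
have e20 : 0 < e ^+ 2 by rewrite exprn_gt0.
have e21 : e ^+ 2 <= 1 by rewrite exprn_ile1 ?(ltW e0).
have sq (y : R) : 2 * ln n%:R <= y -> expR (- y) <= n%:R^-1 ^+ 2.
  move=> hy; apply: (@le_trans _ _ (expR (- (2 * ln n%:R)))).
    by rewrite ler_expR lerN2.
  by rewrite expRN expRM_natl lnK ?posrE// exprVn.
have h1 : expR (- (e ^+ 2 / 8 * x)) <= n%:R^-1 ^+ 2.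
  apply: sq; rewrite (@le_trans _ _ (e ^+ 2 / 8 * (16 / e ^+ 2 * ln n%:R)))//.
    by rewrite le_eqVlt; apply/orP; left; apply/eqP; field; rewrite gt_eqF.
  by rewrite ler_wpM2l// divr_ge0// ltW.
have h2 : expR (- (x / 2)) <= n%:R^-1 ^+ 2.
  apply: sq; rewrite ler_pdivlMr//; apply: le_trans hx.
  have : 16 * ln n%:R <= 16 / e ^+ 2 * ln n%:R.
    by rewrite ler_wpM2r ?(ltW ln0)// ler_peMr// invf_ge1.
  by lra.
set q := expR (- (x / 2)) in h2 *.
have q0 : 0 <= q by exact: expR_ge0.
(* (1 + q) ^ n <= expR (n q), and n q is at most 1 / n. *)
have nq : n%:R * q <= n%:R^-1.
  by apply: (le_trans (ler_wpM2l (ltW n0) h2)); rewrite expr2 mulrA mulfV ?mul1r// gt_eqF.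
have ninv : n%:R^-1 <= 1 / 2 :> R.
  by rewrite div1r lef_pV2 ?posrE// -[2]/(2%:R) ler_nat.
have h3 : (1 + q) ^+ n <= 1 + 2 * n%:R^-1.
  apply: (@le_trans _ _ (expR (n%:R * q))).
    rewrite expRM_natl lerXn2r// ?nnegrE ?expR_ge0//; first by rewrite addr_ge0.
    exact: expR_ge1Dx.
  have nq0 : 0 <= n%:R * q by rewrite mulr_ge0.
  apply: le_trans (expR_le_quadratic (le_trans nq ninv)) _.
  have : 2 * (n%:R * q) ^+ 2 <= n%:R * q.
    rewrite expr2 mulrA -[leRHS]mul1r ler_wpM2r//.
    by have := le_trans nq ninv; lra.
  by lra.
have h4 : C * n%:R * expR (- (e ^+ 2 / 8 * x)) <= C * n%:R^-1.
  rewrite -mulrA ler_wpM2l//; apply: (le_trans (ler_wpM2l (ltW n0) h1)).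
  by rewrite expr2 mulrA mulfV ?mul1r// gt_eqF.
by rewrite mulrDl; lra.
Qed.

Lemma sampled_coupled (d : measure_display) (Omega : measurableType d)
    (R : realType) (n : nat) (al : R)
    (A : 'I_n -> 'I_n -> {mfun Omega >-> bool}) (w : Omega) (u : R -> 'rV[R]_n) (S : R) :
  sampled_kuramoto al (adjacency_mx R A w) u ->
  coupled_on (n%:R * al)^-1 (edge_rel A w) 0 S (fun i t => u t 0 i).
Proof.
move=> hu; split=> [i|i t /andP[t0 _]].
  apply: continuous_subspaceW (hu i).1.
  by apply: subset_itvl; rewrite bnd_simp.
rewrite (_ : coupling _ _ _ _ = (n%:R * al)^-1 *
    \sum_(j < n) adjacency_mx R A w i j * sin (u t 0 j - u t 0 i)).
  exact: (hu i).2.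
by congr (_ * _); apply: eq_bigr => j _; rewrite mxE.
Qed.

Lemma rV_norm_cvg_const (R : realType) (n : nat) (u : R -> 'rV[R]_n) (m : R) :
  (forall e : R, 0 < e -> exists t1, forall t i, t1 <= t -> `|u t 0 i - m| < e) ->
  `|u t - const_mx m| @[t --> +oo] --> (0 : R).
Proof.
move=> h; apply/cvgrPdist_le => e e0; have [t1 ht1] := h e e0.
near=> t; rewrite sub0r normrN normr_id.
have t1t : t1 <= t by near: t; apply: nbhs_pinfty_ge; exact: num_real.
rewrite /Num.norm/=; set x := u t - const_mx m.
have [->|/mx_norm_neq0[[i j] ->]] := eqVneq (mx_norm x) 0; first exact: ltW.
by rewrite /= /x !mxE (ord1 i) ltW// ht1.
Unshelve. all: by end_near. Qed.

(** * Synchronization on a typical graph *)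

Definition grid_time (R : realType) (T : R) (N s : nat) : R := s%:R * (T / N.+1%:R).

Lemma grid_time_near (R : realType) (T t : R) (N : nat) : 0 < t < T ->
  exists s : 'I_N.+1, `|t - grid_time T N s| <= T / N.+1%:R.
Proof.
move=> /andP[t0 tT]; have T0 : 0 < T by apply: lt_trans tT.
pose h := T / N.+1%:R; have h0 : 0 < h by rewrite divr_gt0.
have th0 : 0 <= t / h by rewrite divr_ge0// ltW.
have /andP[l1 l2] := truncn_itv th0; set s := Num.truncn _ in l1 l2.
have sN : (s < N.+1)%N.
  rewrite -(ltr_nat R); apply: le_lt_trans l1 _.
  have -> : N.+1%:R = T / h :> R by rewrite /h invf_div mulrC divfK// gt_eqF.
  by rewrite ltr_pM2r// invr_gt0.
exists (Ordinal sN); rewrite /grid_time/= -/h ger0_norm.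
  by rewrite lerBlDr -[X in _ <= X + _]mul1r -mulrDl nat1r -ler_pdivrMr// ltW.
by rewrite subr_ge0 -ler_pdivlMr.
Qed.

(** The weights whose row sums must concentrate: the constant 1 controls the
    degrees, and the two signs of the sine at a grid time control the absolute
    value of the fluctuation of the coupling. *)
Definition test_function (R : realType) (theta : R -> R -> R) (T : R) (N n : nat)
    (j : 'I_n * option ('I_N.+1 * bool)) (k : 'I_n) : R :=
  if j.2 is Some (s, b) then
    let t := grid_time T N s in
    (-1) ^+ b * sin (theta t (k%:R / n%:R) - theta t (j.1%:R / n%:R))
  else 1.

Lemma test_function_le1 (R : realType) (theta : R -> R -> R) (T : R) (N n : nat)
    (j : 'I_n * option ('I_N.+1 * bool)) (k : 'I_n) :
  `|test_function theta T j k| <= 1.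
Proof.
rewrite /test_function; case: j.2 => [[s b]|]; last by rewrite normr1.
by rewrite normrMsign ler_norml sin_geN1 sin_le1.
Qed.

(** The arc of radius [r / 4] reached at time [T] consists of [r / 8] for the
    continuum model and [r / 8] for the distance to it; phases then stay in the
    arc of radius [r / 2], where differences are at most [r]. *)
Lemma typical_sync (R : realType) (theta : R -> R -> R) (n N : nat)
    (al T e r c m : R) (a : rel 'I_n) (u : 'I_n -> R -> R) :
  continuum_kuramoto theta -> (0 < n)%N -> 0 < al -> 0 < T -> 0 < e <= 1 -> 0 < r ->
  (forall x : R, `|x| <= r -> x ^+ 2 / 2 <= x * sin x) ->
  8 * e * expR (5 * T) <= r / 8 ->
  (forall x, 0 <= x <= 1 -> `|theta T x - c| <= r / 8) ->
  (forall t y y', 0 <= t <= T -> 0 <= y <= 1 -> 0 <= y' <= 1 ->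
     `|y - y'| <= n%:R^-1 -> `|theta t y - theta t y'| <= e) ->
  T / N.+1%:R <= e ->
  symmetric a -> (forall i j, connect a i j) ->
  (forall j : 'I_n * option ('I_N.+1 * bool),
     \sum_(k < n) ((a j.1 k)%:R - al) * test_function theta T j k <= e * (n%:R * al)) ->
  (forall S, coupled_on (n%:R * al)^-1 a 0 S u) ->
  (forall i : 'I_n, u i 0 = theta 0 (i%:R / n%:R)) ->
  \sum_(i < n) u i 0 = n%:R * m ->
  forall eps, 0 < eps -> exists t1, forall t i, t1 <= t -> `|u i t - m| < eps.
Proof.
move=> ht n0 al0 T0 /andP[e0 e1] r0 hr eT syncT unif NT syma conn dev uk u0 um.
have na0 : 0 < n%:R * al by rewrite mulr_gt0// ltr0n.
have x01 (i : 'I_n) : 0 <= (i%:R / n%:R : R) <= 1.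
  rewrite divr_ge0//= ler_pdivrMr ?ltr0n// mul1r ler_nat; exact: ltnW.
have near_ref := @coupled_near_reference R n N.+1 al T e e e a u
  (fun i t => theta t (i%:R / n%:R)) (fun i t => mean_field theta t (i%:R / n%:R))
  (fun s => grid_time T N s) n0 al0 (ltW e0).
have close i : `|u i T - theta T (i%:R / n%:R)| < r / 8.
  apply: (@lt_le_trans _ _ ((e + e + 6 * e) * expR (5 * T))); last first.
    by apply: le_trans eT; rewrite ler_wpM2r ?expR_ge0//; lra.
  apply: near_ref; last by rewrite lexx ltW.
  - by lra.
  - exact: uk.
  - exact: u0.
  - by move=> j; exact: theta_time_continuous.
  - by move=> j t /andP[t0 _]; apply: (ht.2 _ (x01 j)).2.
  - move=> j t /andP[t0 tT]; apply: mean_field_riemann => //; first exact: ltW.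
    by move=> y y' *; apply: unif => //; rewrite !ltW.
  - move=> t tT; have [s hs] := grid_time_near N tT; exists s => j.
    apply: le_trans NT; apply: le_trans hs; apply: theta_time_lipschitz => //.
      by rewrite mulr_ge0// divr_ge0// ltW.
    by case/andP: tT => /ltW.
  - move=> j; have := dev (j, None); rewrite /test_function/=.
    under eq_bigr do rewrite mulr1.
    rewrite sumrB sumr_const card_ord -[al *+ n]mulr_natl => h.
    have : e * (n%:R * al) <= 1 * (n%:R * al) by rewrite ler_wpM2r// ltW.
    by lra.
  - move=> j s; rewrite ler_norml.
    have := dev (j, Some (s, false)); have := dev (j, Some (s, true)).
    rewrite /test_function/= expr0 expr1.
    under eq_bigr do rewrite mulN1r mulrN.
    rewrite sumrN => h1; under eq_bigr do rewrite mul1r.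
    by move=> h2; rewrite h2 andbT lerNl.
apply: (@connected_arc_sync R n (n%:R * al)^-1 a T (r / 4) (r / 2) c m u) => //.
- by rewrite invr_gt0.
- exact: ltW.
- by lra.
- by move=> x hx; apply: hr; apply: le_trans hx _; lra.
move=> i; have := close i; have := syncT _ (x01 i).
have -> : u i T - c = (u i T - theta T (i%:R / n%:R)) + (theta T (i%:R / n%:R) - c) by ring.
move=> h1 h2; apply: le_trans (ler_normD _ _) _; lra.
Qed.

(** Since alpha <= 1, the hypothesis on ln n / (n alpha ^ 3) is stronger than the
    corresponding one on ln n / (n alpha). *)
Lemma edge_density_large (R : realType) (alpha : nat -> R) (M : R) :
  (forall n, (0 < n)%N -> 0 < alpha n <= 1) ->
  (fun n : nat => ln (n%:R : R) / n%:R / alpha n ^+ 3) @ \oo --> (0 : R) ->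
  0 < M -> \forall n \near \oo, M * ln n%:R <= n%:R * alpha n.
Proof.
move=> halpha hlim M0.
have Mi : 0 < M^-1 by rewrite invr_gt0.
move/cvgrPdist_lt : hlim => /(_ _ Mi) hlim; near=> n.
have n0 : (0 < n)%N by near: n; exact: nbhs_infty_gt.
have /andP[a0 a1] := halpha n n0.
have nR : 0 < n%:R :> R by rewrite ltr0n.
have : `|0 - ln (n%:R : R) / n%:R / alpha n ^+ 3| < M^-1 by near: n.
rewrite sub0r normrN => /(le_lt_trans (ler_norm _)).
have a3 : 0 < alpha n ^+ 3 by rewrite exprn_gt0.
rewrite ltr_pdivrMr// ltr_pdivrMr// => h.
have {}h : M * ln n%:R <= n%:R * alpha n ^+ 3.
  have -> : n%:R * alpha n ^+ 3 = M * (M^-1 * alpha n ^+ 3 * n%:R).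
    by field; rewrite gt_eqF.
  by rewrite ler_pM2l// ltW.
apply: (le_trans h); rewrite ler_pM2l// exprS ler_piMr ?(ltW a0)//.
by rewrite exprn_ile1// ltW.
Unshelve. all: by end_near. Qed.

Unset Implicit Arguments.

Theorem theorem4p1 (R : realType)
    (alpha : nat -> R)
    (halpha : forall n, (0 < n)%N -> 0 < alpha n <= 1)
    (halpha_lim :
      (fun n : nat => ln (n%:R : R) / n%:R / alpha n ^+ 3) @ \oo --> (0 : R))
    (theta : R -> R -> R)
    (htheta : continuum_kuramoto theta)
    (htheta0 : {within `[0, 1], continuous (theta 0)})
    (c : R)
    (hsync :
      Linfty01_norm (fun x => theta t x - c) @[t --> +oo] --> 0%E)
    (d : measure_display) (Omega : measurableType d) (P : probability Omega R)
    (A : forall n : nat, 'I_n -> 'I_n -> {mfun Omega >-> bool})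
    (hA : forall n, erdos_renyi P (alpha n) (A n))
    (* [i : 'I_n] is the paper's index [i.+1] *)
    (thetan : forall n : nat, Omega -> R -> 'rV[R]_n)
    (hthetan : forall n w,
      sampled_kuramoto (alpha n) (adjacency_mx R (A n) w) (thetan n w))
    (hthetan0 : forall n w (i : 'I_n),
      thetan n w 0 0 i = theta 0 (i%:R / n%:R))
    (delta : R) (hdelta : 0 < delta) :
  exists (ctilde : nat -> R) (nbar : nat), forall n : nat, (nbar < n)%N ->
    let E : set Omega :=
      [set w | `|thetan n w t - const_mx (ctilde n)| @[t --> +oo] --> (0 : R)] in
    measurable E /\ ((1 - delta)%:E <= P E)%E.
Proof.
have [r r0 hr] := sin_ge_half_near0 R.
have [T T0 syncT] := sync_time htheta htheta0 hsync (divr_gt0 r0 (ltr0n R 8)).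
(* The three errors of the comparison up to time T are all taken equal to e;
   1 + 1 + 6 = 8 is the total weight they have there. *)
pose e := Num.min 1 (r / 8 / (8 * expR (5 * T))).
have e01 : 0 < e <= 1.
  by rewrite lt_min ltr01/= !divr_gt0// ?mulr_gt0 ?expR_gt0//= ge_min lexx.
have /andP[e0 e1] := e01.
have eT : 8 * e * expR (5 * T) <= r / 8.
  have -> : 8 * e * expR (5 * T) = e * (8 * expR (5 * T)) by ring.
  by rewrite -ler_pdivlMr ?mulr_gt0 ?expR_gt0// ge_min lexx orbT.
have [h h0 unif] := theta_space_unif htheta htheta0 T e0.
pose N := Num.truncn (T / e).
have NT : T / N.+1%:R <= e.
  rewrite ler_pdivrMr// mulrC -ler_pdivrMr// ltW//.
  by have /andP[] := truncn_itv (divr_ge0 (ltW T0) (ltW e0)).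
(* The number of linear functionals tested on each row. *)
pose C : R := (1 + N.+1 * 2)%:R.
pose m (n : nat) : R := n%:R^-1 * \sum_(i < n) theta 0 (i%:R / n%:R).
have dens := edge_density_large halpha halpha_lim
  (divr_gt0 (ltr0n R 16) (exprn_gt0 2 e0)).
have [nbar _ hnbar] : \forall n \near \oo,
    [/\ (1 < n)%N, n%:R^-1 <= h, (C + 2) / n%:R <= delta &
     16 / e ^+ 2 * ln n%:R <= n%:R * alpha n].
  near=> n.
  have n1 : (1 < n)%N by near: n; exact: nbhs_infty_gt.
  have n0 : 0 < n%:R :> R by rewrite ltr0n ltnW.
  split => //.
  - rewrite -[n%:R^-1]mul1r ler_pdivrMr// mulrC -ler_pdivrMr//.
    by near: n; exact: nbhs_infty_ger.
  - rewrite ler_pdivrMr// mulrC -ler_pdivrMr//.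
    by near: n; exact: nbhs_infty_ger.
  - by near: n.
exists m, nbar => n /ltnW/hnbar[n1 nh nd dn] E.
have n0 : (0 < n)%N by exact: ltnW.
have /andP[al0 al1] := halpha n n0.
have al01 : 0 <= alpha n <= 1 by rewrite ltW.
have uk w S := sampled_coupled S (hthetan n w).
have k0 : 0 <= (n%:R * alpha n)^-1 by rewrite invr_ge0 mulr_ge0// ltW.
(* E is a union of fibers of the adjacency matrix: two sample points with the
   same graph have the same solution. *)
have mE : measurable E.
  have := measurable_graph_event (A n) (fun a => exists2 w, E w & graph_at (A n) w = a).
  rewrite (_ : [set w | _] = E)//.
  apply/seteqP; split => [w /= [w' Ew' ww']|w Ew]; last by exists w.
  have same t i : 0 <= t -> thetan n w' t 0 i = thetan n w t 0 i.
    move=> t0; apply: (@coupled_unique R n _ (edge_rel (A n) w) t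
      (fun i t => thetan n w' t 0 i) (fun i t => thetan n w t 0 i) k0) => //.
    - rewrite (_ : edge_rel (A n) w = edge_rel (A n) w') //.
      apply/funext => k; apply/funext => l.
      by have := congr1 (fun a : {ffun _ -> _} => a (k, l)) ww'; rewrite !ffunE.
    - by move=> j; rewrite !hthetan0.
    - by rewrite t0 lexx.
  apply: cvg_trans Ew'; apply: near_eq_cvg; near=> t.
  have t0 : 0 <= t by near: t; apply: nbhs_pinfty_ge; exact: num_real.
  by congr (`| _ - _ |); apply/rowP => i; rewrite same.
split => //.
pose J := ('I_n * option ('I_N.+1 * bool))%type.
have le1 (j : J) k := @test_function_le1 R theta T N n j k.
pose G := typical_graph (alpha n) (A n) (fun j : J => j.1) (fun j => test_function theta T j) e.
have mG : measurable G by exact: measurable_typical_graph.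
have PG : ((1 - delta)%:E <= P G)%E.
  apply: (typical_graph_probability (hA n) al01 (fun j : J => j.1) le1 e01).
  apply: le_trans nd.
  have -> : #|{: J}|%:R = C * n%:R :> R.
    by rewrite card_prod card_option card_prod !card_ord card_bool natrM mulrC.
  exact: typical_graph_asymptotics.
apply: (le_trans PG); apply: le_measure; rewrite ?inE// => w [conn dev].
apply: rV_norm_cvg_const.
apply: (@typical_sync R theta n N (alpha n) T e r c (m n) (edge_rel (A n) w)
  (fun i t => thetan n w t 0 i)) => //.
- move=> t y y' tT y01 y'01 yy'; apply/ltW/unif => //; exact: le_trans nh.
- by move=> k l; have [sym _ _] := hA n; exact: sym.
- rewrite /m mulVKf ?gt_eqF ?ltr0n//.
  by apply: eq_bigr => i _; rewrite hthetan0.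
Unshelve. all: by end_near. Qed.
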